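(* Consider the Pólya-Gamma Gibbs sampler (defined in the context) for regularized Bayesian bridge logistic regression, with bridge exponent $a\in(0,1)$, fixed slab width $\zeta>0$, arbitrary design matrix $\boldsymbol X\in\mathbb R^{n\times p}$ and binary outcomes $\boldsymbol y\in\{0,1\}^n$. If the global scale prior $\pi_{\rm glo}(\cdot)$ is supported on $[\tau_{\min},\infty)$ for some $\tau_{\min}>0$, then the Gibbs sampler is uniformly ergodic.
   Context: Model: $y_i\mid\boldsymbol x_i,\boldsymbol\beta\sim\mathrm{Bernoulli}(\mathrm{logit}^{-1}(\boldsymbol x_i^\top\boldsymbol\beta))$ for $i=1,\dots,n$ ($\boldsymbol x_i^\top$ the rows of $\boldsymbol X$); fictitious data $z_j=0$ with $z_j\mid\beta_j\sim\mathcal N(\beta_j,\zeta^2)$; $\beta_j\mid\tau,\lambda_j\sim\mathcal N(0,\tau^2\lambda_j^2)$, $\lambda_j\sim\pi_{\rm loc}$ independently for $j=1,\dots,p$, $\tau\sim\pi_{\rm glo}$. Bayesian bridge prior: $\pi_{\rm loc}(\lambda)\propto\lambda^{-2}\pi_{\rm st}(\lambda^{-2}/2)$ on $(0,\infty)$, where $\pi_{\rm st}$ is the density of the one-sided (positive) stable distribution with characteristic exponent $a/2$, characterized by $\int_0^\infty e^{-su}\pi_{\rm st}(u)\,du=\exp(-s^{a/2})$, $s\ge 0$. The resulting marginal is $\pi(\beta_j\mid\tau)\propto\tau^{-1}\exp(-|\beta_j/\tau|^a)$. Pólya-Gamma distribution $\mathrm{PG}(1,c)$ (shape $1$, tilting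 $c$): the law of $\frac{1}{2\pi^2}\sum_{k\ge1}\frac{g_k}{(k-1/2)^2+c^2/(4\pi^2)}$ with $g_k$ i.i.d. standard exponential. Gibbs sampler: a transition $(\boldsymbol\omega^*,\boldsymbol\beta^*,\boldsymbol\lambda^*,\tau^* )\to(\boldsymbol\omega,\boldsymbol\beta,\boldsymbol\lambda,\tau)$ consists of: (1) draw $\tau$ from the collapsed conditional $\pi(\tau\mid\boldsymbol\beta^* )\propto\pi_{\rm glo}(\tau)\,\tau^{-p}\prod_{j}\exp(-|\beta_j^*/\tau|^a)$; (2) draw $\lambda_j$ independently from $\pi(\lambda_j\mid\beta_j^*,\tau)\propto\lambda_j^{-1}\exp(-\beta_j^{*2}/(2\tau^2\lambda_j^2))\,\pi_{\rm loc}(\lambda_j)$; (3) draw $\omega_i\sim\mathrm{PG}(1,\boldsymbol x_i^\top\boldsymbol\beta^* )$ independently for $i=1,\dots,n$; (4) draw $\boldsymbol\beta\sim\mathcal N(\boldsymbol\Phi^{-1}\boldsymbol X^\top(\boldsymbol y-\tfrac12\boldsymbol 1),\boldsymbol\Phi^{-1})$ with $\boldsymbol\Phi=\boldsymbol X^\top\mathrm{diag}(\boldsymbol\omega)\boldsymbol X+\zeta^{-2}\boldsymbol I+\tau^{-2}\mathrm{diag}(\boldsymbol\lambda)^{-2}$. Uniform ergodicity: there are $M<\infty$, $\rho<1$ such that the total variation distance between the $k$-step distribution from any starting point and the stationary distribution is at most $M\rho^k$ for all $k$. *)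

(* Defs.v *)
From HB Require Import structures.
From mathcomp Require Import all_boot all_order all_algebra.
From mathcomp Require Import all_classical all_reals all_analysis.
Set Implicit Arguments.
Unset Strict Implicit.
Unset Printing Implicit Defensive.
Import Order.TTheory GRing.Theory Num.Theory.
Import numFieldNormedType.Exports.
Local Open Scope classical_set_scope.
Local Open Scope ring_scope.

(* Lebesgue measure on p.-tuple R: the image of the iterated product measure
   under (x, t) |-> x :: t, starting from the unit mass at the empty tuple. *)
Section lebesgue_tuple.
Context {R : realType}.

Definition tcons m (xt : measurableTypeR R * m.-tuple R) : m.+1.-tuple R :=
  [tuple of xt.1 :: xt.2].

Lemma measurable_tcons m : measurable_fun [set: _] (@tcons m).
Proof.
exact: (@measurable_cons _ _ _ R fst m snd measurable_fst measurable_snd).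
Qed.

Section pushcons.
Context (lam : {sigma_finite_measure set (measurableTypeR R) -> \bar R}).
Context m (mu : {sigma_finite_measure set (m.-tuple R) -> \bar R}).
Local Open Scope ereal_scope.

Definition pushcons : set (m.+1.-tuple R) -> \bar R :=
  pushforward (lam \x mu) (@tcons m).

Let push := measure_function_pushforward__canonical__measure_function_Measure
  (lam \x mu) (@measurable_tcons m).

Let pushcons0 : pushcons set0 = 0. Proof. exact: (measure0 push). Qed.

Let pushcons_ge0 A : 0 <= pushcons A. Proof. exact: (measure_ge0 push). Qed.

Let pushcons_sigma_additive : semi_sigma_additive pushcons.
Proof. exact: (@measure_semi_sigma_additive _ _ _ push). Qed.

HB.instance Definition _ := isMeasure.Build _ _ _ pushcons
  pushcons0 pushcons_ge0 pushcons_sigma_additive.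

Let sigma_finite_pushcons : sigma_finite setT pushcons.
Proof.
have /sigma_finiteP[F [FT ndF Foo]] := sigma_finiteT lam.
have /sigma_finiteP[G [GT ndG Goo]] := sigma_finiteT mu.
pose u (t : m.+1.-tuple R) : measurableTypeR R * m.-tuple R :=
  (tnth t ord0, [tuple of behead t]).
have mu_ : measurable_fun [set: _] u.
  apply: measurable_fun_pair; first exact: measurable_tnth.
  exact: measurable_behead.
exists (fun k => u @^-1` (F k `*` G k)).
  rewrite -preimage_bigcup (_ : \bigcup_k _ = setT) ?preimage_setT//.
  rewrite -subTset => -[x t] _.
  have [i _ Fx] : (\bigcup_k F k) x by rewrite -FT.
  have [j _ Gt] : (\bigcup_k G k) t by rewrite -GT.
  exists (maxn i j) => //; split => /=.
  - by move: x Fx; exact/subsetPset/ndF/leq_maxl.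
  - by move: t Gt; exact/subsetPset/ndG/leq_maxr.
move=> k; have [mF ?] := Foo k; have [mG ?] := Goo k; split.
  by rewrite -[X in measurable X]setTI; apply: mu_ => //; exact: measurableX.
rewrite /pushcons /pushforward -comp_preimage (_ : u \o @tcons m = id).
  by rewrite product_measure1E// lte_mul_pinfty// ge0_fin_numE.
by apply/funext => -[x t]; congr pair; exact: val_inj.
Qed.

HB.instance Definition _ :=
  Measure_isSigmaFinite.Build _ _ _ pushcons sigma_finite_pushcons.

End pushcons.

Fixpoint lebesgue_tuple (p : nat) :
    {sigma_finite_measure set (p.-tuple R) -> \bar R} :=
  if p is m.+1 return {sigma_finite_measure set (p.-tuple R) -> \bar R}
  then pushcons lebesgue_measure (lebesgue_tuple m)
  else @dirac _ _ ([tuple] : 0.-tuple R) R.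

End lebesgue_tuple.

Section markov_chains.
Context d (T : measurableType d) (R : realType).
Local Open Scope ereal_scope.

Fixpoint kstep (K : R.-pker T ~> T) (k : nat) (x : T) (A : set T) : \bar R :=
  if k is k'.+1 then \int[K x]_y kstep K k' y A else \d_x A.

Definition stationary (K : R.-pker T ~> T) (pi : probability T R) :=
  forall A, measurable A -> \int[pi]_x K x A = pi A.

Definition tv_dist (mu nu : set T -> \bar R) : \bar R :=
  ereal_sup [set `|mu A - nu A| | A in [set A | measurable A]].

Definition uniformly_ergodic (K : R.-pker T ~> T) :=
  exists2 pi : probability T R, stationary K pi &
  exists M rho : R, (0 <= rho < 1)%R /\
    forall (x : T) (k : nat), tv_dist (kstep K k x) pi <= (M * rho ^+ k)%:E.

End markov_chains.

Section random_variables.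
Context d (T : measurableType d) (R : realType) (P : probability T R).

Definition mutually_independent (J : choiceType) (X : J -> {RV P >-> R}) :=
  forall (s : seq J) (A : J -> set R), uniq s ->
    (forall j, measurable (A j)) ->
    P (\bigcap_(j in [set` s]) (X j @^-1` A j)) =
    (\prod_(j <- s) P (X j @^-1` A j))%E.

Definition iid_exponential (J : choiceType) (g : J -> {RV P >-> R}) :=
  mutually_independent g /\
  forall j A, measurable A -> P (g j @^-1` A) = exponential_prob 1 A.

End random_variables.

Section densities.
Context {R : realType}.

(* The density on D with respect to mu that is proportional to w. *)
Definition normalized d (T : measurableType d) (mu : {measure set T -> \bar R})
    (D : set T) (w : T -> R) (x : T) : R :=
  w x / fine (\int[mu]_(z in D) (w z)%:E).

Definition colv m (b : m.-tuple R) : 'cV[R]_m := \col_j tnth b j.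

(* Density of N(m, S); the normalizing integral is sqrt ((2 pi)^p det S). *)
Definition mvnormal_pdf p (m : 'cV[R]_p) (S : 'M[R]_p) (b : p.-tuple R) : R :=
  normalized (lebesgue_tuple p) [set: p.-tuple R]
    (fun z => expR (- 2^-1 *
       ((colv z - m)^T *m invmx S *m (colv z - m)) ord0 ord0)) b.

Definition stable_density (alpha : R) (f : R -> R) :=
  [/\ measurable_fun (`]0, +oo[%classic : set R) f, (forall u, 0 < u -> 0 <= f u) &
    forall s, 0 <= s ->
      (\int[lebesgue_measure]_(u in `]0%R, +oo[) (expR (- (s * u)) * f u)%:E =
       (expR (- (s `^ alpha)))%:E)%E].

Definition bridge_local_prior (a : R) (pi_loc : R -> R) :=
  exists2 pi_st : R -> R, stable_density (a / 2) pi_st &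
  (exists2 c : R, 0 < c & forall l, 0 < l ->
     pi_loc l = c * (l ^- 2 * pi_st (l ^- 2 / 2))) /\
  (\int[lebesgue_measure]_(l in `]0%R, +oo[) (pi_loc l)%:E = 1)%E.

(* The sum of the PG(1, c) representation for a realization g 0, g 1, ... of
   the exponential variables; the index k here is k - 1 in the usual series. *)
Definition polya_gamma_sum (g : nat -> R) (c : R) : R :=
  (2 * pi ^+ 2)^-1 *
  fine (\sum_(0 <= k <oo)
    (g k / ((k.+1%:R - 2^-1) ^+ 2 + c ^+ 2 / (4 * pi ^+ 2)))%:E)%E.

End densities.

Section gibbs.
Context {R : realType}.
Variables (n p : nat) (X : 'M[R]_(n, p)) (y : 'I_n -> bool).
Variables (a zeta : R) (pi_loc : R -> R) (pi_glo : probability R R).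
Context d (Omega : measurableType d) (P : probability Omega R).
Variable g : 'I_n * nat -> {RV P >-> R}.

(* States (omega, beta, lambda, tau). A transition depends on its starting
   state only through beta, so the positivity of the starting omega, lambda
   and tau need not be built into the type. *)
Definition state : Type := (n.-tuple R * p.-tuple R * p.-tuple R * R)%type.

Definition tau_density (b : p.-tuple R) : R -> R :=
  normalized pi_glo `]0, +oo[
    (fun t => t ^- p * \prod_(j < p) expR (- (`|tnth b j / t| `^ a))).

Definition lambda_density (bj t : R) : R -> R :=
  normalized lebesgue_measure `]0, +oo[
    (fun l => l^-1 * expR (- (bj ^+ 2 / (2 * t ^+ 2 * l ^+ 2))) * pi_loc l).

(* A sample of omega given beta: coordinate i has law PG(1, x_i^T beta), and
   the coordinates are independent since the g (i, k) are. *)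
Definition omega_sample (b : p.-tuple R) (th : Omega) : n.-tuple R :=
  [tuple polya_gamma_sum (fun k => g (i, k) th) ((X *m colv b) i ord0)
    | i < n].

Definition precision (w : n.-tuple R) (l : p.-tuple R) (t : R) : 'M[R]_p :=
  X^T *m diag_mx (colv w)^T *m X + (zeta ^- 2)%:M
  + t ^- 2 *: diag_mx (\row_j (tnth l j) ^- 2).

Definition beta_density (w : n.-tuple R) (l : p.-tuple R) (t : R) :
    p.-tuple R -> R :=
  let S := invmx (precision w l t) in
  mvnormal_pdf (S *m X^T *m \col_i ((y i)%:R - 2^-1)) S.

Definition gibbs_transition (s : state) (A : set state) : \bar R :=
  let b := s.1.1.2 in
  (\int[pi_glo]_(t in `]0%R, +oo[) ((tau_density b t)%:E *
   \int[lebesgue_tuple p]_(l in [set l | forall j, (0 < tnth l j)%R])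
     ((\prod_(j < p) lambda_density (tnth b j) t (tnth l j))%:E *
   \int[P]_th
   \int[lebesgue_tuple p]_b'
     ((beta_density (omega_sample b th) l t b')%:E *
      (\1_A (omega_sample b th, b', l, t))%:E))))%E.

Definition gibbs_kernel (K : R.-pker state ~> state) :=
  forall s A, measurable A -> K s A = gibbs_transition s A.

End gibbs.

(* Main.v *)
Require Import Defs.
From HB Require Import structures.
From mathcomp Require Import all_boot all_order all_algebra.
From mathcomp Require Import all_classical all_reals all_analysis.
From mathcomp Require Import measurable_realfun.
From mathcomp Require Import ring lra.
Set Implicit Arguments.
Unset Strict Implicit.
Unset Printing Implicit Defensive.
Import Order.TTheory GRing.Theory Num.Theory.
Import numFieldNormedType.Exports.
Local Open Scope classical_set_scope.
Local Open Scope ring_scope.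

(** Given [beta], the conditional law of the next state does not depend on the
    other coordinates of the current one, so the chain is governed by its
    [beta]-marginal, and it suffices to bound the transitions of that marginal
    below by a fixed nonzero measure (Doeblin).

    The substitution [u = l^-2 / 2] turns the conditional law of [l] into the
    stable law tilted by [exp (- (beta / tau)^2 u)].  Tilting decreases [u]
    stochastically, hence with probability at least 1/2, uniformly in [beta] and
    [tau], [u] stays below a median of the stable law itself.  Likewise
    PG(1, c) is dominated by PG(1, 0), so the [omega] are bounded with
    probability at least 1/2.  As [tau >= tau_min], on these events the
    precision matrix is bounded; it is always at least [zeta^-2], so the
    Gaussian density of the next [beta] is bounded below on the unit box. *)

(** * Doeblin's theorem *)

(** The stationary law is not written down as a posterior: the Doeblin argument produces it, as a
    geometric series in the kernel left over once the minorant is removed. The transition is an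
    iterated integral over densities with normalizers, so that it is a kernel at all has to be
    proved. The normalizer of [lambda] is the Laplace transform of the stable law, known in closed
    form; those of [tau] and [beta] are controlled by Tonelli and explicit bounds. The bound
    [tau_min] serves twice: in the precision matrix, and in making the law of [tau] proper, since at
    [beta = 0] its weight is [t^-p]. The exponentials behind [omega] are nonnegative only almost
    surely, and a negative [omega] could spoil the invertibility of the precision; they are replaced
    by their positive parts, which leaves the transition probabilities unchanged. A bounded
    precision matrix alone does not bound the Gaussian density below: its mean must be controlled
    too. The quadratic form at the mean is at most [zeta^2] times the squared norm of
    [X^T (y - 1/2)], whatever the weights, and the normalizer is at most that of a centred normal of
    variance [zeta^2] in each coordinate. *)

Section measure_bind.
Context d d' (X : measurableType d) (Y : measurableType d') (R : realType).
Implicit Type mu : {measure set X -> \bar R}.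
Local Open Scope ereal_scope.

(** The kernel need not be finite: besides Markov steps, this serves the substitution
    [u = l^-2 / 2], with Lebesgue measure as [mu] and a kernel of unbounded mass. *)
Definition bind mu (k : R.-ker X ~> Y) (B : set Y) := \int[mu]_x k x B.

Let bind0 mu k : bind mu k set0 = 0.
Proof. by rewrite /bind (eq_integral (cst 0)) ?integral0// => x _; rewrite measure0. Qed.

Let bind_ge0 mu k B : 0 <= bind mu k B. Proof. exact: integral_ge0. Qed.

Let bind_sigma_additive mu k : semi_sigma_additive (bind mu k).
Proof.
move=> F mF tF mUF; rewrite [X in _ --> X](_ : _ =
    \int[mu]_x (\sum_(n <oo) k x (F n))); last first.
  apply: eq_integral => x _.
  by apply/esym/cvg_lim => //; exact/measure_semi_sigma_additive.
apply/cvg_closeP; split.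
  by apply: is_cvg_nneseries => n _ _; exact: integral_ge0.
by rewrite closeE// integral_nneseries// => n; exact: measurable_kernel.
Qed.

HB.instance Definition _ mu k := isMeasure.Build _ _ _
  (bind mu k) (bind0 mu k) (bind_ge0 mu k) (@bind_sigma_additive mu k).

Definition mbind mu k : {measure set Y -> \bar R} := bind mu k.

Lemma mbindE mu k B : mbind mu k B = \int[mu]_x k x B.
Proof. by []. Qed.

Import HBNNSimple.

Let integral_mbind_nnsfun mu k (f : {nnsfun Y >-> R}) :
  \int[mbind mu k]_z (f z)%:E = \int[mu]_x \int[k x]_z (f z)%:E.
Proof.
under [in RHS]eq_integral do rewrite integralT_nnsfun sintegralE.
rewrite integralT_nnsfun sintegralE ge0_integral_fsum//.
- apply: eq_fsbigr => r _; rewrite mbindE.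
  have [r0|r0] := leP 0%R r.
    by rewrite ge0_integralZl_EFin//; exact: measurable_kernel.
  rewrite preimage_nnfun0// (eq_integral (cst 0)) ?integral0 ?mule0//.
    by rewrite (eq_integral (cst 0)) ?integral0// => x _; rewrite measure0 ?mule0.
  by move=> x _; rewrite measure0.
- by move=> r; apply: measurable_funeM; exact: measurable_kernel.
- move=> r x _; exact: nnsfun_mulemu_ge0.
Qed.

(** Simple functions first, then monotone convergence in the inner and the outer integral. *)
Lemma integral_mbind mu k (f : Y -> \bar R) :
  (forall z, 0 <= f z) -> measurable_fun [set: Y] f ->
  \int[mbind mu k]_z f z = \int[mu]_x \int[k x]_z f z.
Proof.
move=> f0 mf; pose f_ := nnsfun_approx measurableT mf.
have ndf : forall x, nondecreasing_seq (fun n => (f_ n x)%:E).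
  by move=> x m n mn; rewrite lee_fin; exact/lefP/nd_nnsfun_approx.
have intf (m : {measure set Y -> \bar R}) :
    \int[m]_z f z = limn (fun n => \int[m]_z (f_ n z)%:E).
  rewrite -monotone_convergence//.
  - by apply: eq_integral => z _; apply/esym/cvg_lim => //; exact: cvg_nnsfun_approx.
  - by move=> n; exact/measurable_EFinP.
  - by move=> n z _; rewrite lee_fin.
rewrite intf; under [RHS]eq_integral do rewrite intf.
rewrite monotone_convergence//.
- by congr (limn _); apply/funext => n; rewrite integral_mbind_nnsfun.
- move=> n; apply: measurable_fun_integral_kernel.
  + by move=> A mA; exact: measurable_kernel.
  + by move=> z; rewrite lee_fin.
  + exact/measurable_EFinP.
- by move=> n x _; apply: integral_ge0 => z _; rewrite lee_fin.
- move=> x _ m n mn; apply: ge0_le_integral => //.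
  + by move=> z _; rewrite lee_fin.
  + exact/measurable_EFinP.
  + exact/measurable_EFinP.
  + by move=> z _; exact: ndf.
Qed.

End measure_bind.

Lemma ge0_integral_between d (T : measurableType d) (R : realType)
    (mu : {measure set T -> \bar R}) (f : T -> \bar R) (m M : R) :
  measurable_fun setT f -> (0 <= m)%R -> (forall x, m%:E <= f x <= M%:E)%E ->
  (m%:E * mu setT <= \int[mu]_x f x <= M%:E * mu setT)%E.
Proof.
move=> mf m0 fmM.
have f0 x : (0 <= f x)%E.
  by have /andP[+ _] := fmM x; apply: le_trans; rewrite lee_fin.
rewrite -!integral_cst//; apply/andP; split; apply: ge0_le_integral => //.
  by move=> x _; case/andP: (fmM x).
by move=> x _; case/andP: (fmM x).
Qed.

Section probability_of_measure.
Context d (T : measurableType d) (R : realType).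
Variables (m : {measure set T -> \bar R}) (m1 : m setT = 1%E).

Let pm of m setT = 1%E : set T -> \bar R := m.

HB.instance Definition _ := Measure.copy (pm m1) m.
HB.instance Definition _ := Measure_isProbability.Build _ _ _ (pm m1) m1.

Lemma probability_of_measure : exists P : probability T R, forall A, P A = m A.
Proof. by exists (pm m1). Qed.

End probability_of_measure.

Section pker_of_ker.
Context d d' (X : measurableType d) (Y : measurableType d') (R : realType).
Variables (k : R.-ker X ~> Y) (k1 : forall x, k x setT = 1%E).

Let pk of (forall x, k x setT = 1%E) : X -> {measure set Y -> \bar R} := k.

HB.instance Definition _ := Kernel.copy (pk k1) k.
HB.instance Definition _ := Kernel_isProbability.Build _ _ _ _ _ (pk k1) k1.

Lemma pker_of_ker : exists K : R.-pker X ~> Y, forall x A, K x A = k x A.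
Proof. by exists (pk k1). Qed.

End pker_of_ker.

Section doeblin.
Context d (U : measurableType d) (R : realType).
Variables (H : R.-pker U ~> U) (mu0 : {measure set U -> \bar R}).
Local Open Scope ereal_scope.

Lemma pker1 d1 d2 (V : measurableType d1) (W : measurableType d2)
  (K : R.-pker V ~> W) x : K x [set: W] = 1.
Proof. exact: prob_kernel. Qed.

Hypothesis minor : forall u B, measurable B -> mu0 B <= H u B.
Hypothesis mu0_gt0 : 0 < mu0 [set: U].

Lemma minor_le1 (u : U) : mu0 [set: U] <= 1.
Proof. by rewrite -(pker1 H u); exact: minor. Qed.

Let mu0_fin (u : U) B : measurable B -> mu0 B \is a fin_num.
Proof.
move=> mB; rewrite ge0_fin_numE//; apply: (@le_lt_trans _ _ (mu0 setT)).
  by apply: le_measure; rewrite ?inE.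
by apply: (le_lt_trans (minor_le1 u)); rewrite ltry.
Qed.

(** The residual [H - mu0] is nonnegative by the minorization, and countably additive as a
    difference of convergent series, [mu0] being finite. *)
Lemma kernel_sub_minorant :
  exists r : R.-ker U ~> U, forall u B, measurable B -> H u B = r u B + mu0 B.
Proof.
have mres u : exists r : {measure set U -> \bar R},
    forall B, measurable B -> H u B = r B + mu0 B.
  (* A measure must be nonnegative on every set, while the minorization speaks of measurable sets
     only; hence the value 0 elsewhere. *)
  pose f B := if B \in measurable then H u B - mu0 B else 0.
  have fE B : measurable B -> f B = H u B - mu0 B.
    by move=> mB; rewrite /f ifT// inE.
  have f0 : f set0 = 0 by rewrite fE// !measure0 sube0.
  have f_ge0 B : 0 <= f B.
    by rewrite /f; case: ifPn => // /[!inE] mB; rewrite sube_ge0 ?minor ?(mu0_fin u)//.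
  have fs : semi_sigma_additive f.
    move=> F mF tF mUF; rewrite fE//.
    have -> : (fun n => \sum_(0 <= i < n) f (F i)) =
        (fun n => \sum_(0 <= i < n) H u (F i) - \sum_(0 <= i < n) mu0 (F i)).
      apply/funext => n.
      rewrite -sumeN; last first.
        by move=> i j _ _; rewrite fin_num_adde_defr// (mu0_fin u).
      by rewrite -big_split; apply: eq_bigr => i _; rewrite fE.
    apply: cvgeB.
    - by rewrite fin_num_adde_defl// fin_numN (mu0_fin u).
    - exact: measure_semi_sigma_additive.
    - exact: measure_semi_sigma_additive.
  pose m : {measure set U -> \bar R} :=
    HB.pack f (isMeasure.Build _ _ _ f f0 f_ge0 fs).
  exists m => B mB; rewrite /m/= fE// subeK// (mu0_fin u)//.
have [r rE] := choice mres.
have mr : forall B, measurable B -> measurable_fun [set: U] (r ^~ B).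
  move=> B mB; rewrite (_ : r ^~ B = fun u => H u B - mu0 B).
    by apply: emeasurable_funB => //; exact: measurable_kernel.
  by apply/funext => u; rewrite rE// addeK// (mu0_fin u).
pose r' : R.-ker U ~> U := HB.pack r (isKernel.Build _ _ _ _ _ r mr).
by exists r'.
Qed.

(** The law is the sum over [k] of [mu0 r^k], with [r] the residual kernel. Applying [H = r + mu0]
    shifts the series by one and adds [mu0] times the total mass; that mass is 1, so the first term
    is restored. *)
Lemma doeblin_stationary (u0 : U) :
  exists2 piH : {measure set U -> \bar R}, piH setT = 1 &
  forall B, measurable B -> \int[piH]_u H u B = piH B.
Proof.
have [r rE] := kernel_sub_minorant.
set E := fine (mu0 setT).
have EE : mu0 setT = E%:E by rewrite fineK// (mu0_fin u0).
have E0 : (0 < E)%R by rewrite -lte_fin -EE.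
have E1 : (E <= 1)%R by rewrite -lee_fin -EE; exact: minor_le1 u0.
have rT u : r u setT = (1 - E)%:E.
  have := rE u setT measurableT; rewrite pker1 EE EFinB => ->.
  by rewrite addeK.
(* [it k] is [mu0 r^k]. As [r] has constant mass [1 - E], the masses [E (1 - E)^k] are a geometric
   law and sum to 1. *)
pose it := fix it k : {measure set U -> \bar R} :=
  if k is k'.+1 then mbind (it k') r else mu0.
have itT k : it k setT = (E * (1 - E) ^+ k)%:E.
  elim: k => [|k IH]; first by rewrite expr0 mulr1.
  rewrite /= mbindE (eq_integral (cst (1 - E)%:E))//.
  by rewrite integral_cst// IH -EFinM exprSr; congr EFin; ring.
have sumT : \sum_(0 <= k <oo) it k setT = 1.
  apply/cvg_lim => //.
  have -> : (fun n => \sum_(0 <= k < n) it k setT) =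
      EFin \o (fun n => 1 - (1 - E) ^+ n)%R.
    apply/funext; elim => [|n IH]; first by rewrite big_nil/= expr0 subrr.
    by rewrite big_nat_recr//= IH /= itT -EFinD exprS; congr EFin; ring.
  apply: cvg_EFin; first by apply: nearW.
  rewrite -[X in _ --> X]subr0; apply: cvgB; first exact: cvg_cst.
  by apply: cvg_expr; rewrite ger0_norm ?subr_ge0//; lra.
exists (mseries it 0) => [//|B mB].
rewrite ge0_integral_measure_series//; last exact: measurable_kernel.
under eq_eseriesr => k _.
  under eq_integral => u _ do rewrite rE//.
  rewrite ge0_integralD//; last exact: measurable_kernel.
  rewrite integral_cst// -mbindE.
  over.
rewrite /= nneseriesD//.
have -> : \sum_(0 <= k <oo) mu0 B * it k setT = mu0 B.
  rewrite -(fineK (mu0_fin u0 mB)) nneseriesZl; last by move=> k _.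
  by rewrite sumT mule1.
rewrite /mseries [RHS]nneseries_recl//= addeC; congr (_ + _).
by rewrite -[RHS](@nneseries_addn _ _ 1)//=; apply: eq_eseriesr => k _; rewrite addn1.
Qed.

(** Of the two parts of [H u], the integral against [mu0] is the same for all [u], and the one
    against the residual varies in an interval of length [D (1 - E)], the residual having mass
    [1 - E]. *)
Lemma doeblin_osc (u0 : U) (f : U -> \bar R) (m D : R) :
  measurable_fun setT f -> (0 <= m)%R ->
  (forall u, m%:E <= f u <= (m + D)%:E) ->
  exists2 m' : R, (0 <= m')%R &
    forall u, m'%:E <= \int[H u]_v f v <=
              (m' + D * (1 - fine (mu0 setT)))%:E.
Proof.
move=> mf m0 fmD.
have f0 u : 0 <= f u by have /andP[+ _] := fmD u; apply: le_trans; rewrite lee_fin.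
have [r rE] := kernel_sub_minorant.
set E := fine (mu0 setT).
have EE : mu0 setT = E%:E by rewrite fineK// (mu0_fin u0).
have E0 : (0 < E)%R by rewrite -lte_fin -EE.
have E1 : (E <= 1)%R by rewrite -lee_fin -EE; exact: minor_le1 u0.
have rT u : r u setT = (1 - E)%:E.
  have := rE u setT measurableT; rewrite pker1 EE EFinB => ->.
  by rewrite addeK.
have HE u : \int[H u]_v f v = \int[r u]_v f v + \int[mu0]_v f v.
  rewrite -ge0_integral_measure_add//.
  by apply: eq_measure_integral => A mA _; rewrite rE// [RHS]measure_addE.
have bnd mu := ge0_integral_between mu mf m0 fmD.
have i0 : \int[mu0]_v f v \is a fin_num.
  rewrite ge0_fin_numE ?integral_ge0//.
  by have /andP[_ /le_lt_trans] := bnd mu0; apply; rewrite EE -EFinM ltry.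
exists (m * (1 - E) + fine (\int[mu0]_v f v))%R.
  by rewrite addr_ge0 ?mulr_ge0 ?subr_ge0 ?fine_ge0 ?integral_ge0.
move=> u; rewrite HE; have := bnd (r u); rewrite rT => /andP[b1 b2].
rewrite !EFinD !fineK//; apply/andP; split.
  by rewrite leeD// EFinM.
rewrite addeAC leeD//; apply: (le_trans b2).
by rewrite -EFinM -!EFinD lee_fin; lra.
Qed.

End doeblin.

(** * Chains whose transitions depend on the current state through a statistic [b] *)

Section doeblin_factor.
Context d d' (U : measurableType d) (T : measurableType d') (R : realType).
Variables (G : R.-pker U ~> T) (b : T -> U) (K : R.-pker T ~> T).
Variable mu0 : {measure set U -> \bar R}.
Local Open Scope ereal_scope.
Hypothesis mb : measurable_fun [set: T] b.
Hypothesis KE : forall x A, measurable A -> K x A = G (b x) A.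
Hypothesis minor : forall u B, measurable B -> mu0 B <= G u (b @^-1` B).
Hypothesis mu0_gt0 : 0 < mu0 [set: U].

Let measurable_b B : measurable B -> measurable (b @^-1` B).
Proof. by move=> mB; rewrite -[X in measurable X]setTI; exact: mb. Qed.

(** The marginal chain: draw a full state from [G u] and keep its image under [b]. *)
Let H_ex : exists H : R.-pker U ~> U, forall u B, H u B = G u (b @^-1` B).
Proof.
pose h u : {measure set U -> \bar R} :=
  measure_function_pushforward__canonical__measure_function_Measure (G u) mb.
have hE u B : h u B = G u (b @^-1` B) by [].
have mh B : measurable B -> measurable_fun setT (h ^~ B).
  by move=> mB; exact/measurable_kernel/measurable_b.
pose h' : R.-ker U ~> U := HB.pack h (isKernel.Build _ _ _ _ _ h mh).
have h1 u : h' u setT = 1 by rewrite /h'/= hE preimage_setT pker1.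
by have [K' K'E] := pker_of_ker h1; exists K' => u B; rewrite K'E.
Qed.

Let kstep_ge0 k x A : 0 <= kstep K k x A.
Proof. by elim: k x => [|k IH] x //=; apply: integral_ge0 => ? _; exact: IH. Qed.

Let measurable_kstep k A : measurable A ->
  measurable_fun [set: T] (fun x => kstep K k x A).
Proof.
move=> mA; elim: k => [|k IH] /=.
  apply: measurable_fun_dirac => //.
apply: (@measurable_fun_integral_kernel _ _ _ _ _ _ _ (fun z => kstep K k z A)) => //.
- by move=> B mB; exact: measurable_kernel.
Qed.

Theorem uniformly_ergodic_of_minorization : uniformly_ergodic K.
Proof.
have [H HE] := H_ex.
have u0 : U by exact: b point.
have minorH u B : measurable B -> mu0 B <= H u B by move=> ?; rewrite HE minor.
have [piH piH1 piHE] := doeblin_stationary minorH mu0_gt0 u0.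
have intH u (f : U -> \bar R) : (forall v, 0 <= f v) -> measurable_fun setT f ->
    \int[H u]_v f v = \int[G u]_x f (b x).
  move=> f0 mf; rewrite -[RHS](ge0_integral_pushforward mb (G u) measurableT mf)//.
  by apply: eq_measure_integral => A mA _; exact: HE.
have intK x (f : T -> \bar R) : \int[K x]_y f y = \int[G (b x)]_y f y.
  by apply: eq_measure_integral => A mA _; exact: KE.
(* The stationary law of the full chain: draw the statistic from its stationary law, then make one
   transition [G]. *)
pose p0 := mbind piH G.
have p01 : p0 setT = 1.
  by rewrite /p0 mbindE (eq_integral (cst 1)) ?integral_cst ?piH1 ?mule1// => u _;
    rewrite pker1.
have [pi piE] := probability_of_measure p01.
have int_pi (f : T -> \bar R) : \int[pi]_x f x = \int[p0]_x f x.
  by apply: eq_measure_integral => A _ _; exact: piE.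
have stat : stationary K pi.
  move=> A mA; rewrite int_pi integral_mbind//; last exact: measurable_kernel.
  rewrite piE [RHS]mbindE -[RHS](@eq_measure_integral _ _ _ _ _ (mbind piH H)); last first.
    by move=> B mB _; rewrite mbindE piHE.
  rewrite integral_mbind//; last exact: measurable_kernel.
  apply: eq_integral => u _; rewrite intH//; last exact: measurable_kernel.
  by apply: eq_integral => x _; rewrite KE.
have statk k A : measurable A -> \int[pi]_x kstep K k x A = pi A.
  move=> mA; elim: k => [|k IH] /=.
    by rewrite -[in RHS](setIT A) -integral_indic.
  rewrite -IH -integral_mbind//; last exact: measurable_kstep.
  by apply: eq_measure_integral => B mB _; rewrite mbindE stat.
pose r0 := (1 - fine (mu0 setT))%R.
have r0_ge0 : (0 <= r0)%R.
  have := minor_le1 minorH u0; have := measure_ge0 mu0 setT.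
  by rewrite /r0; case: (mu0 setT) => [r||]//=; rewrite !lee_fin => _; lra.
have r0_lt1 : (r0 < 1)%R.
  have := minor_le1 minorH u0; have := mu0_gt0.
  by rewrite /r0; case: (mu0 setT) => [r||]//=; rewrite lte_fin => ? _; lra.
(* A transition [G] followed by [k] steps of [K] is [k] steps of the marginal chain followed by [G],
   so each step shrinks the range over [u] by the factor [r0]. *)
have osc A k : measurable A -> exists2 m : R, (0 <= m)%R & forall u,
    m%:E <= \int[G u]_x kstep K k x A <= (m + r0 ^+ k)%:E.
  move=> mA; elim: k => [|k [m m0 mh]].
    exists 0%R => // u /=; rewrite integral_ge0//= add0r expr0.
    apply: (@le_trans _ _ (\int[G u]_x cst 1 x)); last first.
      by rewrite integral_cst// pker1 mule1.
    by apply: ge0_le_integral => //; [exact: (measurable_kstep 0)|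
      move=> x _; rewrite diracE lee_fin; case: (_ \in _)].
  have mG : measurable_fun setT (fun u => \int[G u]_x kstep K k x A).
    apply: (@measurable_fun_integral_kernel _ _ _ _ _ _ _ (fun z => kstep K k z A)) => //.
    - by move=> B mB; exact: measurable_kernel.
    - exact: measurable_kstep.
  have [m' m'0 m'h] := doeblin_osc minorH mu0_gt0 u0 mG m0 mh.
  exists m' => // u; rewrite exprSr; have := m'h u; rewrite intH//; last first.
    by move=> v; apply: integral_ge0 => *; exact: kstep_ge0.
  by under eq_integral do rewrite -intK.
(* The first step of [K] merely enters [G], so [k + 1] steps contract by [r0^k] only. With
   [rho >= 1/2] the constant 2 absorbs this shift: [r0^k <= 2 rho^(k+1)]. *)
pose rho := Num.max r0 2^-1%R.
have rho_half : (2^-1 <= rho)%R by rewrite /rho le_max lexx orbT.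
have rho_r0 : (r0 <= rho)%R by rewrite /rho le_max lexx.
have rho_lt1 : (rho < 1)%R by rewrite /rho gt_max r0_lt1/=; lra.
exists pi => //; exists 2%R, rho; split; first by rewrite rho_lt1 andbT; lra.
move=> x k; apply: ge_ereal_sup => _ [A mA <-].
(* One interval of length [D] holds the [k]-step probabilities of [A] from all starting points,
   hence also their average under [pi], which is [pi A] by stationarity. *)
have [m m_ge0 [D mD [mk mp]]] : exists2 m : R, (0 <= m)%R & exists2 D : R,
    (D <= 2 * rho ^+ k)%R & m%:E <= kstep K k x A <= (m + D)%:E /\
    forall y, m%:E <= kstep K k y A <= (m + D)%:E.
  case: k => [|k].
    exists 0%R => //; exists 1%R; first by rewrite expr0; lra.
    by rewrite add0r; split=> [|y] /=; rewrite diracE; case: (_ \in _);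
      rewrite !lee_fin ler01 lexx.
  have [m m0 mh] := osc A k mA.
  exists m => //; exists (r0 ^+ k)%R.
    rewrite (@le_trans _ _ (rho ^+ k)%R)//; first by rewrite lerXn2r// nnegrE; lra.
    by rewrite exprS mulrA ler_peMl ?exprn_ge0//; lra.
  by split => [|y]; rewrite /= intK; exact: mh.
have : m%:E <= pi A <= (m + D)%:E.
  have := ge0_integral_between pi (measurable_kstep k mA) m_ge0 mp.
  have pi1 : pi setT = 1 by rewrite piE.
  by rewrite statk//= pi1 !mule1.
move: mk; case: (kstep _ _ _ _) => [u||]; case: (pi A) => [v||] //=;
  rewrite ?leye_eq ?leeNy_eq ?andbF//= !lee_fin => /andP[? ?] /andP[? ?].
by rewrite (le_trans _ mD)// ler_norml; lra.
Qed.
End doeblin_factor.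

(** * Kernels given by densities, and Lebesgue measure on tuples *)

Lemma emeasurable_prod d (T : measurableType d) (R : realType) (I : Type)
    (s : seq I) (h : I -> T -> \bar R) :
  (forall i, measurable_fun setT (h i)) ->
  measurable_fun setT (fun x => \prod_(i <- s) h i x)%E.
Proof.
move=> mh; elim: s => [|i s IH].
  by under eq_fun do rewrite big_nil; exact: measurable_cst.
by under eq_fun do rewrite big_cons; exact: emeasurable_funM.
Qed.

Section kernel_steps.
Context (R : realType).
Local Open Scope ereal_scope.

(** Lets an integral formula be called a probability kernel without packaging it. Agreement is on
    measurable sets, as in [gibbs_kernel]. *)
Definition is_pker d d' (X : measurableType d) (Z : measurableType d')
    (F : X -> set Z -> \bar R) :=
  exists K : R.-pker X ~> Z, forall x A, measurable A -> K x A = F x A.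

Lemma is_pker_dirac d d' (X : measurableType d) (Z : measurableType d')
    (f : X -> Z) : measurable_fun setT f ->
  is_pker (fun x A => (\1_A (f x))%:E).
Proof. by move=> mf; exists (kdirac mf). Qed.

Section density.
Context d1 d2 d3 (X : measurableType d1) (Y : measurableType d2)
  (Z : measurableType d3).
Variables (mu : {sigma_finite_measure set Y -> \bar R}) (k : R.-pker (X * Y) ~> Z).
Variable w : X * Y -> R.
Hypotheses (w0 : forall z, (0 <= w z)%R) (mw : measurable_fun setT w).
Hypothesis w1 : forall x, \int[mu]_y (w (x, y))%:E = 1.

Definition kdensity x A := \int[mu]_y ((w (x, y))%:E * k (x, y) A).

Let mwk A : measurable A -> measurable_fun setT (fun z => (w z)%:E * k z A).
Proof. 
move=> mA; apply: emeasurable_funM; first exact/measurable_EFinP.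
exact: measurable_kernel.
Qed.

Let kdensity0 x : kdensity x set0 = 0.
Proof.
by rewrite /kdensity (eq_integral (cst 0)) ?integral0// => y _; rewrite measure0 mule0.
Qed.

Let kdensity_ge0 x A : 0 <= kdensity x A.
Proof. by apply: integral_ge0 => y _; rewrite mule_ge0 ?lee_fin. Qed.

Let kdensity_sigma_additive x : semi_sigma_additive (kdensity x).
Proof.
move=> F mF tF mUF; rewrite /kdensity.
rewrite [X in _ --> X](_ : _ =
    \int[mu]_y (\sum_(n <oo) ((w (x, y))%:E * k (x, y) (F n)))); last first.
  apply: eq_integral => y _; rewrite nneseriesZl//; congr (_ * _).
  by apply/esym/cvg_lim => //; exact/measure_semi_sigma_additive.
apply/cvg_closeP; split.
  by apply: is_cvg_nneseries => n _ _; exact: kdensity_ge0.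
rewrite closeE// integral_nneseries// => n.
  exact: measurableT_comp (mwk (mF n)) _.
by move=> y _; rewrite mule_ge0 ?lee_fin.
Qed.

HB.instance Definition _ x := isMeasure.Build _ _ _
  (kdensity x) (kdensity0 x) (kdensity_ge0 x) (@kdensity_sigma_additive x).

Let mk_kdensity x : {measure set Z -> \bar R} := kdensity x.

Let measurable_kdensity A : measurable A -> measurable_fun setT (mk_kdensity ^~ A).
Proof.
move=> mA; apply: (@measurable_fun_fubini_tonelli_F _ _ _ _ _ mu (fun z => (w z)%:E * k z A)).
- exact: mwk.
- by move=> z; rewrite mule_ge0 ?lee_fin.
Qed.

HB.instance Definition _ := isKernel.Build _ _ _ _ _ mk_kdensity measurable_kdensity.

Let kdensityT x : mk_kdensity x setT = 1.
Proof.
rewrite -(w1 x); apply: eq_integral => y _.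
by rewrite (pker1 k) mule1.
Qed.

Lemma is_pker_kdensity : is_pker kdensity.
Proof.
have [K KE] := pker_of_ker kdensityT.
by exists K => x A mA; rewrite KE.
Qed.

End density.

(** One draw of the sampler: [x] is the history, [y] the new variable, and [F] the kernel of all
    later draws. The sampler is thus built backwards, from a Dirac mass at the completed state. *)
Lemma is_pker_density d1 d2 d3 (X : measurableType d1) (Y : measurableType d2)
    (Z : measurableType d3) (mu : {sigma_finite_measure set Y -> \bar R})
    (D : set Y) (w : X * Y -> R) (F : X * Y -> set Z -> \bar R) :
  measurable D -> measurable_fun (setT `*` D) w ->
  (forall x y, D y -> (0 <= w (x, y))%R) ->
  (forall x, \int[mu]_(y in D) (w (x, y))%:E = 1) ->
  is_pker F ->
  is_pker (fun x A => \int[mu]_(y in D) ((w (x, y))%:E * F (x, y) A)).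
Proof.
move=> mD mw w0 w1 [k kF].
pose w' := w \_ (setT `*` D).
have w'E x y : (w' (x, y))%:E = ((fun y => (w (x, y))%:E) \_ D) y.
  by rewrite /w' !patchE/= in_setX/= in_setT/=; case: ifP.
have [|||K KE] := @is_pker_kdensity _ _ _ _ _ _ mu k w'.
- move=> [x y]; rewrite -lee_fin w'E patchE; case: ifPn => // /[!inE] Dy.
  by rewrite lee_fin w0.
- by apply/(measurable_restrictT _ _).1; [exact: measurableX|exact: mw].
- by move=> x; rewrite -(w1 x) [RHS]integral_mkcond; apply: eq_integral => y _.
exists K => x A mA; rewrite KE// [RHS]integral_mkcond; apply: eq_integral => y _.
by rewrite w'E !patchE; case: ifPn => _; rewrite ?mul0e ?kF.
Qed.

End kernel_steps.

(** * Tonelli for Lebesgue measure on tuples *)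

Section lebesgue_tuple_integral.
Context (R : realType).
Local Open Scope ereal_scope.

Lemma integral_lebesgue_tupleS m (f : m.+1.-tuple R -> \bar R) :
  measurable_fun setT f -> (forall t, 0 <= f t) ->
  \int[lebesgue_tuple m.+1]_t f t =
  \int[lebesgue_measure]_x \int[lebesgue_tuple m]_t f [tuple of x :: t].
Proof.
move=> mf f0.
transitivity (\int[lebesgue_measure \x lebesgue_tuple m]_z f (tcons z)).
  exact: (ge0_integral_pushforward (@measurable_tcons R m)).
rewrite (@fubini_tonelli1 _ _ _ _ _ _ _ (f \o @tcons R m))//; last by move=> z; exact: f0.
by apply: measurableT_comp => //; exact: measurable_tcons.
Qed.

Lemma integral_lebesgue_tuple_prod p (f : 'I_p -> R -> \bar R) :
  (forall j, measurable_fun setT (f j)) -> (forall j x, 0 <= f j x) ->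
  \int[lebesgue_tuple p]_t (\prod_(j < p) f j (tnth t j)) =
  \prod_(j < p) \int[lebesgue_measure]_x f j x.
Proof.
elim: p f => [|p IH] f mf f0.
  by rewrite big_ord0; under eq_integral do rewrite big_ord0; rewrite integral_dirac// diracT mule1.
have mtn q (h : 'I_q -> R -> \bar R) : (forall j, measurable_fun setT (h j)) ->
    measurable_fun setT (fun t : q.-tuple R => \prod_(j < q) h j (tnth t j)).
  move=> mh; apply: emeasurable_prod => j.
  exact: measurableT_comp (mh j) (measurable_tnth j).
rewrite integral_lebesgue_tupleS//; last 2 first.
- exact: mtn.
- by move=> t; apply: prode_ge0.
rewrite big_ord_recl -IH//.
rewrite -ge0_integralZr//; last first.
  by apply: integral_ge0 => t _; exact: prode_ge0.
  exact: (mf ord0).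
apply: eq_integral => x _; rewrite -ge0_integralZl//; last 2 first.
- exact: (mtn _ (fun j => f (lift ord0 j))).
- by move=> t _; exact: prode_ge0.
apply: eq_integral => t _; rewrite big_ord_recl/= (tnth_nth x)/=.
by under eq_bigr do rewrite tnthS.
Qed.

End lebesgue_tuple_integral.

(** The indicator of a product set factors over the coordinates, so the formula on the whole space
    applies to the extensions by zero. *)
Lemma integral_lebesgue_tuple_prod_on (R : realType) p (E : set R) (f : 'I_p -> R -> R) :
  measurable E -> (forall j, measurable_fun E (f j)) ->
  (forall j x, E x -> 0 <= f j x) ->
  (\int[lebesgue_tuple p]_(t in [set t | forall j, E (tnth t j)])
     (\prod_(j < p) f j (tnth t j))%:E =
   \prod_(j < p) \int[lebesgue_measure]_(x in E) (f j x)%:E)%E.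
Proof.
move=> mE mf f0.
rewrite (eq_bigr (fun j => \int[lebesgue_measure]_x ((EFin \o f j) \_ E) x)%E); last first.
  by move=> j _; rewrite integral_mkcond.
rewrite -integral_lebesgue_tuple_prod; last 2 first.
- move=> j; apply/(measurable_restrictT _ _).1 => //.
  exact/measurable_EFinP.
- by move=> j x; apply: erestrict_ge0 => {}x Ex; rewrite lee_fin f0.
rewrite integral_mkcond; apply: eq_integral => t _; rewrite patchE.
case: ifPn => [/[!inE] Et|nEt].
  by rewrite -prodEFin; apply: eq_bigr => j _; rewrite patchE mem_set.
have [j nEj] : exists j, ~ E (tnth t j).
  by apply: contrapT => /forallNP h; move/negP: nEt; apply; rewrite inE => j; exact: contrapT.
by rewrite (bigD1 j)//= patchE memNset// mul0e.
Qed.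

Lemma measurable_tuple_all (R : realType) p (E : set R) : measurable E ->
  measurable [set t : p.-tuple R | forall j, E (tnth t j)].
Proof.
move=> mE.
have -> : [set t : p.-tuple R | forall j, E (tnth t j)] =
    \big[setI/setT]_(j < p) ((fun z : p.-tuple R => tnth z j) @^-1` E).
  rewrite -bigcap_seq; apply/seteqP; split => z /= Ez j => [_|]; first exact: Ez.
  exact: Ez (mem_index_enum j).
apply: bigsetI_measurable => j _; rewrite -[X in measurable X]setTI.
exact: measurable_tnth.
Qed.

(** * The substitution u = l^-2 / 2 *)

Section inverse_square_substitution.
Context {R : realType}.
Local Open Scope ereal_scope.
Notation leb := (@lebesgue_measure R).

(** The point 0, where the inverse is 0 by convention, is split off; on the open complement the
    inverse is continuous. *)
Lemma measurable_inv_fun : measurable_fun setT (@GRing.inv R).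
Proof.
have m0 : measurable ([set 0%R] : set R) by exact: measurable_set1.
have -> : setT = [set 0%R] `|` ~` [set 0%R] :> set R by rewrite setUv.
apply/measurable_funU => //; first exact: measurableC.
split; first exact: measurable_fun_set1.
apply: open_continuous_measurable_fun.
  by apply: closed_openC; exact: closed_eq.
by move=> x; rewrite inE/= => /eqP x0; exact: inv_continuous.
Qed.

Let continuous_Vexpn n (x : R) : x != 0%R ->
  {for x, continuous (fun l : R => l ^- n)%R}.
Proof.
move=> x0; apply: (@cvgV _ R); first by rewrite expf_neq0.
exact: exprn_continuous.
Qed.

(** The image of [l^-3 dl] under [l^-2 / 2] gives []0, b]] its length: the preimage is a half-line
    [[al, +oo[], on which [- l^-2 / 2] is an antiderivative of the weight. *)
Lemma integral_inv_cube (b : R) : (0 < b)%R ->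
  \int[leb]_(l in `]0%R, +oo[) ((l ^- 3)%:E * (\1_`]0%R, b] (l ^- 2 / 2 : R)%R)%:E) = b%:E.
Proof.
move=> b0; pose al := (Num.sqrt (2 * b))^-1%R.
have al0 : (0 < al)%R by rewrite invr_gt0 sqrtr_gt0 mulr_gt0.
have al2 : (al ^- 2 / 2 = b)%R.
  rewrite /al exprVn invrK sqr_sqrtr ?mulr_ge0 ?ltW//.
  by rewrite mulrAC divff ?mul1r.
transitivity (\int[leb]_(l in `[al, +oo[) (l ^- 3)%:E).
  rewrite [LHS]integral_mkcond [RHS]integral_mkcond; apply: eq_integral => l _.
  rewrite !patchE; have [l0|l0] := ltP 0%R l; last first.
    rewrite !ifF//; apply/negbTE; rewrite notin_setE/= in_itv/= andbT; apply/negP.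
      by rewrite -ltNge (le_lt_trans l0).
    by rewrite -leNgt.
  rewrite ifT; last by rewrite inE/= in_itv/= l0.
  rewrite indicE; have -> : ((l ^- 2 / 2)%R \in (`]0%R, b]%classic : set R)) = (l \in `[al, +oo[%classic).
    rewrite !mem_setE !in_itv/= andbT.
    rewrite divr_gt0 ?invr_gt0 ?exprn_gt0//= -al2 ler_pM2r ?invr_gt0//.
    by rewrite lef_pV2 ?posrE ?exprn_gt0// ler_pXn2r// nnegrE ltW.
  by case: ifPn => _; rewrite ?mule1 ?mule0.
have dF (x : R) : (0 < x)%R -> is_derive x 1%R (fun l : R => - (l ^- 2 / 2))%R (x ^- 3)%R.
  move=> x0.
  have x2 : (x ^+ 2 != 0)%R by rewrite expf_neq0// gt_eqF.
  have h := @is_deriveV R (fun l : R => l ^+ 2)%R x 1%R _ x2 _.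
  rewrite (_ : (fun l : R => _) = (fun l : R => (- 2^-1) * l ^- 2)%R); last first.
    by apply/funext => l; rewrite mulrC mulNr.
  apply: is_derive_eq.
  rewrite /GRing.scale/= mulr1.
  by field; rewrite gt_eqF.
have F0 : (- (x ^- 2 / 2))%R @[x --> +oo%R] --> (0:R)%R.
  have V0 : (x^-1)%R @[x --> +oo%R] --> (0:R)%R.
    by apply/gtr0_cvgV0; [near do by []|exact: cvg_id].
  rewrite (_ : (fun x : R => _) = (fun x : R => - (x^-1 * x^-1 / 2))%R); last first.
    by apply/funext => x; rewrite expr2 invfM.
  rewrite -[X in _ --> X]oppr0 -[in X in _ --> X](mul0r 2^-1%R) -[in X in _ --> X](mul0r 0%R).
  by apply: cvgN; apply: cvgM; [apply: cvgM => //|exact: cvg_cst].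
rewrite (@ge0_continuous_FTC2y _ _ (fun l => - (l ^- 2 / 2))%R _ 0%R)//.
- by rewrite sub0e -EFinN opprK al2.
- by move=> x ax; rewrite invr_ge0 exprn_ge0// (le_trans (ltW al0)).
- apply: continuous_in_subspaceT => x; rewrite inE/= in_itv/= andbT => ax.
  by apply: continuous_Vexpn; rewrite gt_eqF// (lt_le_trans al0).
- by move=> x ax; have [] := dF x (lt_trans al0 ax).
- apply: cvg_at_right_filter; apply: cvgN; apply: cvgM; last exact: cvg_cst.
  by apply: continuous_Vexpn; rewrite gt_eqF.
- move=> x; rewrite in_itv/= andbT => ax.
  by rewrite derive1E; have [_ ->] := dF x (lt_trans al0 ax).
Unshelve. all: by end_near. Qed.

Let w (l : R) : R := if (0 < l)%R then (l ^- 3)%R else 0%R.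

Let w_ge0 l : (0 <= w l)%R.
Proof. by rewrite /w; case: ifPn => // l0; rewrite invr_ge0 exprn_ge0// ltW. Qed.

Let phi (l : R) : R := (l ^- 2 / 2)%R.

Let measurable_phi : measurable_fun setT phi.
Proof.
apply: measurable_funM => //; apply: measurableT_comp; first exact: measurable_inv_fun.
exact: measurable_funX.
Qed.

Let measurable_w : measurable_fun setT w.
Proof.
apply: measurable_fun_ifT => //; first exact: measurable_fun_ltr.
apply: measurableT_comp; first exact: measurable_inv_fun.
exact: measurable_funX.
Qed.

(** A point mass at [phi l] of weight [l^-3]. Binding it with Lebesgue measure gives the image of
    [l^-3 dl] under [phi], and [integral_mbind] becomes the change of variables. *)
Let kap (l : measurableTypeR R) : {measure set (measurableTypeR R) -> \bar R} :=
  mscale (NngNum (w_ge0 l)) (dirac (phi l : measurableTypeR R)).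

Let kapE l B : kap l B = (w l)%:E * (\1_B (phi l))%:E.
Proof. by []. Qed.

Let measurable_kap B : measurable B -> measurable_fun setT (kap ^~ B).
Proof.
move=> mB; apply: emeasurable_funM; first exact/measurable_EFinP.
by apply/measurable_EFinP; apply: (measurableT_comp (measurable_indic mB)).
Qed.

HB.instance Definition _ := isKernel.Build _ _ (measurableTypeR R) (measurableTypeR R) R kap measurable_kap.

Let nu : {measure set (measurableTypeR R) -> \bar R} := mbind leb kap.

(** Lebesgue measure is characterized on the whole line, while [nu] lives on the positive half; this
    is the other half. *)
Let lneg : {measure set (measurableTypeR R) -> \bar R} :=
  mrestr leb (measurable_itv `]-oo, 0%R]).

Let nu_itv (b : R) : nu `]-oo, b]%classic = (Num.max b 0)%:E.
Proof.
rewrite /nu mbindE; have [b0|b0] := leP b 0%R.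
  rewrite integral0_eq// => l _; rewrite kapE /w.
  have [l0|_] := ltP 0%R l; last by rewrite mul0e.
  rewrite indicE memNset ?mule0//= in_itv/=; apply/negP; rewrite -ltNge (le_lt_trans b0)//.
  by rewrite divr_gt0// invr_gt0 exprn_gt0.
rewrite -(integral_inv_cube b0) [RHS]integral_mkcond; apply: eq_integral => l _.
rewrite kapE patchE mem_setE in_itv/= andbT /w; case: ifPn => l0; last by rewrite mul0e.
rewrite !indicE !mem_setE !in_itv/= /phi.
by rewrite divr_gt0// invr_gt0 exprn_gt0.
Qed.

Let leb_nu (B : set R) : measurable B -> leb B = measure_add nu lneg B.
Proof.
apply: lebesgue_measure_unique => _ [[a b] _ <-].
have [ab|ba] := ltP a b; last by rewrite set_itv_ge ?measure0// bnd_simp -leNgt.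
rewrite [RHS]measure_addE.
have nuD : nu `]-oo, b]%classic = nu `]a, b]%classic + nu `]-oo, a]%classic.
  have := @measureDI _ _ _ nu `]-oo, b]%classic `]-oo, a]%classic.
  rewrite (_ : _ `\` _ = `]a, b]%classic); last first.
    apply/seteqP; split => x /=; rewrite !in_itv/=.
      by move=> [xb /negP]; rewrite -ltNge => ->.
    by move=> /andP[ax xb]; split => //; apply/negP; rewrite -ltNge.
  rewrite (_ : _ `&` _ = `]-oo, a]%classic); first by apply.
  apply/seteqP; split => x /=; rewrite !in_itv/=; first by case.
  by move=> xa; split => //; rewrite (le_trans xa)// ltW.
have -> : nu `]a, b]%classic = (Num.max b 0 - Num.max a 0)%:E.
  by move: nuD; rewrite !nu_itv EFinB => ->; rewrite addeK.
have -> : lneg `]a, b]%classic = leb `]a, Num.min b 0%R]%classic.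
  rewrite /lneg/= /mrestr; congr (leb _); apply/seteqP; split => x /=.
    by rewrite !in_itv/= le_min => -[/andP[-> ->] ->].
  by rewrite !in_itv/= le_min => /and3P[-> -> ->].
rewrite !lebesgue_measure_itv/= !lte_fin ab lt_min ab/=.
rewrite /Num.max /Num.min; case: (ltP b 0%R) => b0; case: (ltP a 0%R) => a0 //=;
  rewrite -?EFinB -?EFinD; try congr EFin; rewrite ?adde0; try congr EFin; try lra.
Qed.

(** Lebesgue measure on the half-line is identified with the image measure [nu], so [f] need only be
    measurable, which is all that is known of a stable density. *)
Lemma integral_inv_square_subst (f : R -> \bar R) :
  measurable_fun (`]0%R, +oo[%classic : set R) f ->
  (forall u, (0 < u)%R -> 0 <= f u) ->
  \int[leb]_(l in `]0%R, +oo[) ((l ^- 3)%:E * f (l ^- 2 / 2)%R) =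
  \int[leb]_(u in `]0%R, +oo[) f u.
Proof.
move=> mf f0.
transitivity (\int[measure_add nu lneg]_(u in `]0%R, +oo[) f u); last first.
  by apply: eq_measure_integral => A mA _; symmetry; exact: leb_nu.
have D0 u : `]0%R, +oo[%classic u -> 0 <= f u by rewrite /= in_itv/= andbT; exact: f0.
rewrite ge0_integral_measure_add//.
rewrite [X in _ = _ + X](_ : _ = 0) ?adde0; last first.
  apply: null_set_integral => //; rewrite /lneg/= /mrestr/= (_ : _ `&` _ = set0) ?measure0//.
  by apply/seteqP; split => x //=; rewrite !in_itv/= andbT => -[]; case: ltgtP.
rewrite [RHS]integral_mkcond integral_mbind//; last 2 first.
- by move=> z; apply: erestrict_ge0.
- exact/(measurable_restrictT _ _).1.
rewrite [LHS]integral_mkcond; apply: eq_integral => l _.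
rewrite ge0_integral_mscale//; last first.
  by move=> ? _; apply: erestrict_ge0.
  exact/(measurable_restrictT _ _).1.
rewrite integral_dirac//= ?diracT ?mul1e; last exact/(measurable_restrictT _ _).1.
rewrite !patchE !mem_setE !in_itv/= !andbT /w; case: ifPn => l0; last by rewrite mul0e.
by rewrite /phi divr_gt0// invr_gt0 exprn_gt0.
Qed.

End inverse_square_substitution.

(** * Local scales *)

Lemma measurable_half_inv_square_le (R : realType) (M : R) :
  measurable [set l : R | 0 < l /\ l ^- 2 / 2 <= M].
Proof.
rewrite (_ : mkset _ = `]0, +oo[%classic `&`
    ((fun l : R => l ^- 2 / 2) @^-1` `]-oo, M]%classic)); last first.
  by apply/seteqP; split => l /=; rewrite !in_itv/= andbT; case.
apply: measurableI => //; rewrite -[X in measurable X]setTI.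
apply: (_ : measurable_fun setT _) => //; apply: measurable_funM => //.
by apply: measurableT_comp; [exact: measurable_inv_fun|exact: measurable_funX].
Qed.

Section bridge_lambda.
Context {R : realType}.
Variables (alpha : R) (f : R -> R) (c : R) (pi_loc : R -> R).
Hypotheses (alpha_gt0 : 0 < alpha) (fstab : stable_density alpha f) (c_gt0 : 0 < c).
Hypothesis pi_locE : forall l, 0 < l -> pi_loc l = c * (l ^- 2 * f (l ^- 2 / 2)).
Notation leb := (@lebesgue_measure R).
Local Open Scope ereal_scope.

Let mf : measurable_fun (`]0%R, +oo[%classic : set R) f. Proof. by case: fstab. Qed.
Let f0 u : (0 < u)%R -> (0 <= f u)%R. Proof. by case: fstab => _ + _; exact. Qed.
Let fL s : (0 <= s)%R ->
  \int[leb]_(u in `]0%R, +oo[) (expR (- (s * u)) * f u)%:E = (expR (- (s `^ alpha)))%:E.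
Proof. by case: fstab => _ _; exact. Qed.

Let D0 u : (`]0%R, +oo[%classic : set R) u -> (0 < u)%R.
Proof. by rewrite /= in_itv/= andbT. Qed.

Lemma measurable_tilt s (D : set R) : D `<=` `]0%R, +oo[%classic -> measurable D ->
  measurable_fun D (fun u => expR (- (s * u)) * f u)%R.
Proof.
move=> sD mD; apply: measurable_funM; last exact: measurable_funS mf.
apply: measurableT_comp => //; apply: measurable_funTS.
by apply: measurableT_comp => //; exact: measurable_funM.
Qed.

(* Exponential tilting moves mass to the left, so the median of the untilted
   law bounds the medians of all the tilted ones. *)
Lemma tilt_median : exists2 M : R, (0 < M)%R & forall s, (0 <= s)%R ->
  (2^-1 * expR (- (s `^ alpha)))%:E <=
  \int[leb]_(u in `]0%R, M]) (expR (- (s * u)) * f u)%:E.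
Proof.
have total0 : \int[leb]_(u in `]0%R, +oo[) (f u)%:E = 1.
  have := fL (lexx 0%R); rewrite powR0 ?gt_eqF// oppr0 expR0 => <-.
  by apply: eq_integral => u _; rewrite mul0r oppr0 expR0 mul1r.
have cup : \bigcup_n `]0%R, n%:R]%classic = `]0%R, +oo[%classic :> set R.
  apply/seteqP; split => [x [n _]|x] /=; rewrite !in_itv/=.
    by move=> /andP[->].
  rewrite andbT => x0; exists (Num.truncn x).+1 => //=.
  by rewrite in_itv/= x0/= ltW// truncnS_gt.
pose A s n := \int[leb]_(u in (`]0%R, n%:R]%classic : set R)) (expR (- (s * u)) * f u)%:E.
have sub n : (`]0%R, n%:R]%classic : set R) `<=` `]0%R, +oo[%classic by exact: subset_itvl.
have cvgA : A 0%R n @[n --> \oo] --> 1.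
  rewrite -total0 -cup.
  under eq_fun => n.
    rewrite /A; under eq_integral do rewrite mul0r oppr0 expR0 mul1r.
    over.
  apply: ge0_nondecreasing_set_cvg_integral => //.
  - by move=> m n mn; apply/subsetPset; apply: subset_itvl; rewrite bnd_simp ler_nat.
  - move=> i; apply/measurable_EFinP; exact: measurable_funS mf.
  - by move=> i x /sub/D0/f0; rewrite lee_fin.
(* [n] is chosen so that the untilted law, of mass 1, puts more than half of it on []0, n]]. *)
have [n An] : exists n, (2^-1)%:E < A 0%R n.
  apply: contrapT => /forallNP h.
  have : 1 <= (2^-1)%:E :> \bar R.
    by apply: (cvge_le _ cvgA); apply: nearW => n; rewrite leNgt; exact/negP/h.
  by rewrite lee_fin; lra.
have n0 : (0 < n%:R :> R)%R.
  rewrite ltr0n lt0n; apply/eqP => n0; move: An.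
  by rewrite n0 /A set_itvoc0 ?ltxx// integral_set0 lte_fin; lra.
exists n%:R => // s s0; rewrite -/(A s n).
pose B s := \int[leb]_(u in (`]n%:R, +oo[%classic : set R)) (expR (- (s * u)) * f u)%:E.
have subB : (`]n%:R, +oo[%classic : set R) `<=` `]0%R, +oo[%classic.
  by apply: subset_itvr; rewrite bnd_simp ltW.
have AB r : (0 <= r)%R -> A r n + B r = (expR (- (r `^ alpha)))%:E.
  move=> r0; rewrite -fL//.
  have -> : `]0%R, +oo[%classic = `]0%R, n%:R]%classic `|` `]n%:R, +oo[%classic :> set R.
    apply/seteqP; split => x /=; rewrite !in_itv/= !andbT.
      by move=> x0; have [xn|xn] := leP x n%:R; [left; rewrite x0|right].
    by case => [/andP[]//|]; exact: lt_trans.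
  rewrite ge0_integral_setU//.
  - apply/measurable_EFinP; apply: measurable_tilt; last exact: measurableU.
    by move=> x [/sub|/subB].
  - by move=> x [/sub|/subB] /D0 x0; rewrite lee_fin mulr_ge0 ?expR_ge0 ?f0.
  - apply/disj_setPRL => x /=; rewrite !in_itv/= andbT => xn.
    by apply/negP; rewrite negb_and -ltNge xn orbT.
have mEt r (D : set R) : D `<=` `]0%R, +oo[%classic -> measurable D ->
    measurable_fun D (fun u => (expR (- (r * u)) * f u)%:E).
  by move=> *; by apply/measurable_EFinP; exact: measurable_tilt.
have ge0 r (D : set R) : D `<=` `]0%R, +oo[%classic ->
    forall u, D u -> 0 <= (expR (- (r * u)) * f u)%:E.
  by move=> DD u /DD/D0 u0; rewrite lee_fin mulr_ge0 ?expR_ge0 ?f0.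
(* The tilt is at least [exp (- s n)] left of [n] and at most that to the right. So [B s <= exp (- s
   n) B 0 <= exp (- s n) A 0 <= A s]: the left part keeps at least half of the total. *)
have le1 : (expR (- (s * n%:R)))%:E * A 0%R n <= A s n.
  rewrite /A -ge0_integralZl//; [|exact: mEt|exact: ge0].
  apply: ge0_le_integral => //.
  - by move=> u un; rewrite mule_ge0 ?(ge0 _ _ (sub n))// lee_fin.
  - by apply: emeasurable_funM => //; exact: mEt.
  - exact: mEt.
  move=> u un; rewrite mul0r oppr0 expR0 mul1r -EFinM lee_fin ler_wpM2r//.
    exact/f0/D0/(sub n).
  by rewrite ler_expR lerN2 ler_wpM2l//; move: un; rewrite /= in_itv/= => /andP[].
have le2 : B s <= (expR (- (s * n%:R)))%:E * B 0%R.
  rewrite /B -ge0_integralZl//; [|exact: mEt|exact: ge0].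
  apply: ge0_le_integral => //.
  - exact: ge0.
  - exact: mEt.
  - by apply: emeasurable_funM => //; exact: mEt.
  move=> u un; rewrite mul0r oppr0 expR0 mul1r -EFinM lee_fin ler_wpM2r//.
    exact/f0/D0/subB.
  by rewrite ler_expR lerN2 ler_wpM2l//; move: un; rewrite /= in_itv/= andbT => /ltW.
have le3 : B 0%R <= A 0%R n.
  move: An (AB 0%R (lexx _)); rewrite powR0 ?gt_eqF// oppr0 expR0.
  by case: (A _ _) => [x||]; case: (B _) => [y||]//=; rewrite ?leey// lte_fin lee_fin
    => hx [hxy]; lra.
have le4 : B s <= A s n.
  by apply: (le_trans le2); apply: le_trans le1; rewrite lee_wpmul2l// lee_fin.
move: le4 (AB s s0); case: (A _ _) => [x||]; case: (B _) => [y||]//=; rewrite ?leey// !lee_fin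
  => hx [hxy]; lra.
Qed.

Lemma measurable_pi_loc : measurable_fun (`]0%R, +oo[%classic : set R) pi_loc.
Proof.
apply: (eq_measurable_fun (fun l : R => c * (l ^- 2 * f (l ^- 2 / 2)))%R).
  by move=> l /[!inE] /D0 l0; rewrite pi_locE.
have mV : measurable_fun setT (fun l : R => l ^- 2)%R.
  by apply: measurableT_comp; [exact: measurable_inv_fun|exact: measurable_funX].
apply: measurable_funM => //; apply: measurable_funM; first exact: measurable_funTS.
apply: (measurable_comp _ _ mf) => //; last first.
  by apply: measurable_funTS; exact: measurable_funM.
by move=> _ [l /D0 l0 <-] /=; rewrite in_itv/= andbT divr_gt0// invr_gt0 exprn_gt0.
Qed.

Lemma measurable_lambda_weight d (T : measurableType d) (D : set T) (b t l : T -> R) :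
  measurable D -> measurable_fun D b -> measurable_fun D t -> measurable_fun D l ->
  (forall x, D x -> (0 < l x)%R) ->
  measurable_fun D (fun x => (l x)^-1 *
    expR (- (b x ^+ 2 / (2 * t x ^+ 2 * l x ^+ 2))) * pi_loc (l x))%R.
Proof.
move=> mD mb mt ml l0; apply: measurable_funM; last first.
  apply: (measurable_comp _ _ measurable_pi_loc) => //.
  by move=> _ [x Dx <-] /=; rewrite in_itv/= andbT l0.
apply: measurable_funM; first exact: measurableT_comp measurable_inv_fun ml.
apply: measurableT_comp => //; apply: measurableT_comp => //.
apply: measurable_funM; first exact: measurable_funX.
apply: measurableT_comp; first exact: measurable_inv_fun.
apply: measurable_funM; last exact: measurable_funX.
by apply: measurable_funM => //; exact: measurable_funX.
Qed.

Section coordinate.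
Variables (b t : R).
Let s : R := (b ^+ 2 / t ^+ 2)%R.

Let s_ge0 : (0 <= s)%R. Proof. by rewrite divr_ge0 ?sqr_ge0. Qed.

(** The [l^-1] of the normal density and the [l^-2] of the prior make up the Jacobian [l^-3], and
    the Gaussian exponent is linear in [u = l^-2 / 2] with slope [s]. *)
Lemma lambda_weightE l : (0 < l)%R ->
  (l^-1 * expR (- (b ^+ 2 / (2 * t ^+ 2 * l ^+ 2))) * pi_loc l =
   l ^- 3 * (c * (expR (- (s * (l ^- 2 / 2))) * f (l ^- 2 / 2))))%R.
Proof.
move=> l0; rewrite pi_locE//.
have -> : (b ^+ 2 / (2 * t ^+ 2 * l ^+ 2) = s * (l ^- 2 / 2))%R.
  by rewrite /s !invfM; ring.
by field; rewrite gt_eqF.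
Qed.

(** Stated for a general set of values of [u]: the half-line gives the normalizer, the interval up
    to the median the probability of the good event. *)
Lemma lambda_mass (D E : set R) : measurable E -> E `<=` `]0%R, +oo[%classic ->
  D = [set l | (0 < l)%R /\ E (l ^- 2 / 2)%R] ->
  \int[leb]_(l in D) (l^-1 * expR (- (b ^+ 2 / (2 * t ^+ 2 * l ^+ 2))) * pi_loc l)%:E =
  c%:E * \int[leb]_(u in E) (expR (- (s * u)) * f u)%:E.
Proof.
move=> mE E0 DE.
have mE' : measurable_fun (`]0%R, +oo[%classic : set R)
    (((fun u => (expR (- (s * u)) * f u)%:E)) \_ E).
  apply/measurable_funTS/(measurable_restrictT _ _).1 => //.
  by apply/measurable_EFinP; exact: measurable_tilt.
have g0 u : (0 < u)%R -> 0 <= ((fun u => (expR (- (s * u)) * f u)%:E) \_ E) u.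
  by move=> u0; rewrite patchE; case: ifPn => // _; rewrite lee_fin mulr_ge0 ?expR_ge0 ?f0.
rewrite -ge0_integralZl; last 4 first.
- by [].
- by apply/measurable_EFinP; exact: measurable_tilt.
- by move=> u /E0/D0 u0; rewrite lee_fin mulr_ge0 ?expR_ge0 ?f0.
- by rewrite lee_fin ltW.
transitivity (\int[leb]_(l in `]0%R, +oo[) ((l ^- 3)%:E *
   (c%:E * ((fun u => (expR (- (s * u)) * f u)%:E) \_ E) (l ^- 2 / 2)%R))).
  rewrite [LHS]integral_mkcond [RHS]integral_mkcond; apply: eq_integral => l _.
  have Dl : (l \in (`]0%R, +oo[%classic : set R)) = (0 < l)%R.
    by rewrite mem_setE in_itv/= andbT.
  rewrite !patchE DE Dl.
  case: ifPn => [/[!inE] -[l0 El]|nD]; last first.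
    case: ifPn => // l0; rewrite ifF ?mule0//.
    by apply/negbTE; apply: contra nD; rewrite !inE.
  by rewrite l0 ifT ?inE// lambda_weightE.
rewrite (integral_inv_square_subst (f := fun u => c%:E * ((fun u => (expR (- (s * u)) * f u)%:E) \_ E) u)).
- rewrite [LHS]integral_mkcond [RHS]integral_mkcond; apply: eq_integral => u _.
  rewrite !patchE; case: ifPn => [u0|nu0]; first by case: ifPn; rewrite ?mule0.
  by rewrite ifF//; apply/negbTE; apply: contra nu0; rewrite !inE => /E0.
- exact: emeasurable_funM.
- by move=> u u0; rewrite mule_ge0 ?g0 ?lee_fin ?ltW.
Qed.

Let setD : `]0%R, +oo[%classic =
  [set l : R | (0 < l)%R /\ (`]0%R, +oo[%classic : set R) (l ^- 2 / 2)%R].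
Proof.
apply/seteqP; split => l /=; rewrite !in_itv/= !andbT; last by case.
by move=> l0; rewrite divr_gt0// invr_gt0 exprn_gt0.
Qed.

(** The Laplace transform at [s] gives a closed form, positive and finite for every [b] and [t]; at
    [t = 0] division by zero makes [s = 0] on both sides. *)
Lemma lambda_normalizer :
  \int[leb]_(l in `]0%R, +oo[) (l^-1 * expR (- (b ^+ 2 / (2 * t ^+ 2 * l ^+ 2))) * pi_loc l)%:E =
  (c * expR (- (s `^ alpha)))%:E.
Proof. by rewrite (lambda_mass _ _ setD)// fL. Qed.

Lemma lambda_densityE l : (0 < l)%R -> lambda_density pi_loc b t l =
  ((l^-1 * expR (- (b ^+ 2 / (2 * t ^+ 2 * l ^+ 2))) * pi_loc l) *
    (c^-1 * expR (s `^ alpha)))%R.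
Proof.
move=> l0; rewrite /lambda_density /normalized lambda_normalizer/=.
by rewrite [(c * _)^-1%R]invfM -expRN opprK.
Qed.

Lemma lambda_density_ge0 l : (0 < l)%R -> (0 <= lambda_density pi_loc b t l)%R.
Proof.
move=> l0; rewrite lambda_densityE// lambda_weightE//.
rewrite !mulr_ge0 ?expR_ge0 ?invr_ge0 ?exprn_ge0 ?f0 ?(ltW l0) ?(ltW c_gt0)//.
by rewrite divr_gt0// invr_gt0 exprn_gt0.
Qed.

Lemma integral_lambda_density (D : set R) :  D `<=` `]0%R, +oo[%classic ->
  measurable D ->
  \int[leb]_(l in D) (lambda_density pi_loc b t l)%:E = 
  (c^-1 * expR (s `^ alpha))%:E *
  \int[leb]_(l in D) (l^-1 * expR (- (b ^+ 2 / (2 * t ^+ 2 * l ^+ 2))) * pi_loc l)%:E.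
Proof.
move=> D0' mD; rewrite -ge0_integralZl//.
- apply: eq_integral => l /[!inE] /D0'/D0 l0.
  by rewrite lambda_densityE// mulrC -EFinM.
- apply/measurable_EFinP; apply: measurable_lambda_weight => //.
  by move=> l /D0'/D0.
- move=> l /D0'/D0 l0; rewrite lee_fin lambda_weightE//.
  rewrite !mulr_ge0 ?expR_ge0 ?invr_ge0 ?exprn_ge0 ?f0 ?(ltW l0) ?(ltW c_gt0)//.
  by rewrite divr_gt0// invr_gt0 exprn_gt0.
- by rewrite lee_fin mulr_ge0 ?expR_ge0// invr_ge0 ltW.
Qed.

Lemma lambda_density_prob :
  \int[leb]_(l in `]0%R, +oo[) (lambda_density pi_loc b t l)%:E = 1.
Proof.
rewrite integral_lambda_density// lambda_normalizer -EFinM; congr EFin.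
by rewrite mulrACA mulVf ?gt_eqF// mul1r expRN mulfV// gt_eqF ?expR_gt0.
Qed.

End coordinate.

Lemma measurable_lambda_density d (T : measurableType d) (D : set T) (b t l : T -> R) :
  measurable D -> measurable_fun D b -> measurable_fun D t -> measurable_fun D l ->
  (forall x, D x -> (0 < l x)%R) ->
  measurable_fun D (fun x => lambda_density pi_loc (b x) (t x) (l x)).
Proof.
move=> mD mb mt ml l0.
apply: (eq_measurable_fun (fun x =>
  ((l x)^-1 * expR (- (b x ^+ 2 / (2 * t x ^+ 2 * l x ^+ 2))) * pi_loc (l x)) *
  (c^-1 * expR ((b x ^+ 2 / t x ^+ 2) `^ alpha)))%R).
  by move=> x /[!inE] Dx; rewrite lambda_densityE// l0.
apply: measurable_funM; first exact: measurable_lambda_weight.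
apply: measurable_funM => //; apply: measurableT_comp => //.
apply: (measurableT_comp (measurable_powR alpha)).
apply: measurable_funM; first exact: measurable_funX.
by apply: measurableT_comp; [exact: measurable_inv_fun|exact: measurable_funX].
Qed.

(** The factor [exp (- s^alpha)] in [tilt_median] cancels against the normalizer, which makes the
    bound uniform in [b] and [t]. *)
Lemma lambda_density_median : exists2 M : R, (0 < M)%R & forall b t,
  (2^-1)%:E <=
  \int[leb]_(l in [set l : R | (0 < l)%R /\ (l ^- 2 / 2 <= M)%R]) (lambda_density pi_loc b t l)%:E.
Proof.
have [M M0 MP] := tilt_median; exists M => // b t.
have E : [set l : R | (0 < l)%R /\ (l ^- 2 / 2 <= M)%R] =
    [set l : R | (0 < l)%R /\ (`]0%R, M]%classic : set R) (l ^- 2 / 2)%R].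
  apply/seteqP; split => l /= [l0]; rewrite in_itv/=; last by move=> /andP[].
  by move=> ->; rewrite divr_gt0// invr_gt0 exprn_gt0.
rewrite integral_lambda_density//; last 2 first.
- by move=> l [l0 _]; rewrite /= in_itv/= l0.
- exact: measurable_half_inv_square_le.
rewrite (lambda_mass _ _ _ _ E)//; last exact: subset_itvl.
set s := (b ^+ 2 / t ^+ 2)%R.
have s0 : (0 <= s)%R by rewrite divr_ge0 ?sqr_ge0.
rewrite muleA -EFinM mulrAC mulVf ?gt_eqF// mul1r.
apply: (@le_trans _ _ ((expR (s `^ alpha))%:E * (2^-1 * expR (- (s `^ alpha)))%:E)).
  by rewrite -EFinM lee_fin mulrCA expRN mulfV ?mulr1// gt_eqF ?expR_gt0.
by rewrite lee_wpmul2l ?MP// lee_fin expR_ge0.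
Qed.

End bridge_lambda.

(** * Polya-Gamma weights *)

Section integral_off_null.
Import HBNNSimple.

(** The integral is a supremum over simple functions below; cutting such a function to the
    complement of [N] keeps its integral and puts it below the other integrand. Hence no
    measurability is asked of [f1] and [f2]. *)
Lemma ge0_eq_integral_off_null d (T : measurableType d) (R : realType)
    (mu : {measure set T -> \bar R}) (N : set T) (f1 f2 : T -> \bar R) :
  measurable N -> mu N = 0%E -> (forall x, 0 <= f1 x)%E -> (forall x, 0 <= f2 x)%E ->
  (forall x, ~ N x -> f1 x = f2 x) -> (\int[mu]_x f1 x = \int[mu]_x f2 x)%E.
Proof.
move=> mN N0 f10 f20 f12.
have key (h1 h2 : T -> \bar R) : (forall x, 0 <= h1 x)%E -> (forall x, 0 <= h2 x)%E ->
    (forall x, ~ N x -> h1 x = h2 x) -> (\int[mu]_x h1 x <= \int[mu]_x h2 x)%E.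
  move=> h10 h20 h12; rewrite !ge0_integralTE//; apply: ge_ereal_sup => _ [h hh1 <-].
  have mNC : measurable (~` N) by exact: measurableC.
  apply: ereal_sup_ubound; exists (proj_nnsfun h mNC).
    move=> x; rewrite -mrestrict patchE; case: ifPn => [/[!inE] Nx|_]; last exact: h20.
    by rewrite -h12// hh1.
  rewrite -!integralT_nnsfun.
  rewrite [RHS](ge0_negligible_integral mN)//; last 2 first.
  - exact/measurable_EFinP.
  - by move=> x _; rewrite lee_fin.
  rewrite setTD [RHS]integral_mkcond; apply: eq_integral => x _.
  by rewrite -mrestrict !patchE; case: ifPn.
by apply/eqP; rewrite eq_le !key// => x /f12.
Qed.

End integral_off_null.

(** The events [W <= n] increase to the whole space, so one of them has probability above 1/2. *)
Lemma probability_le_half d (T : measurableType d) (R : realType)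
    (P : probability T R) (W : T -> R) : measurable_fun setT W ->
  exists2 M : R, 0 <= M & ((2^-1)%:E <= P [set x | (W x <= M)%R])%E.
Proof.
move=> mW.
have mS (n : nat) : measurable [set x | W x <= n%:R].
  by rewrite -[X in measurable X]setTI; apply: measurable_fun_le => //; exact: measurable_cst.
have cv : (P [set x | (W x <= n%:R)%R] @[n --> \oo] --> P setT)%E.
  have -> : setT = \bigcup_n [set x | (W x <= n%:R)%R].
    apply/esym/seteqP; split => // x _; exists (Num.truncn (W x)).+1 => //=.
    by rewrite ltW// truncnS_gt.
  apply: nondecreasing_cvg_mu => //; first exact: bigcupT_measurable.
  move=> m n mn; apply/subsetPset => x /= Wm.
  by apply: (le_trans Wm); rewrite ler_nat.
have [n hn] : exists n : nat, ((2^-1)%:E < P [set x | (W x <= n%:R)%R])%E.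
  apply: contrapT => /forallNP h.
  have : (1 <= (2^-1)%:E :> \bar R)%E.
    rewrite -(@probability_setT _ _ _ P).
    by apply: (cvge_le _ cv); apply: nearW => n; rewrite leNgt; exact/negP/h.
  by rewrite lee_fin; lra.
by exists n%:R => //; exact: ltW.
Qed.

Section polya_gamma.
Context {R : realType}.
Implicit Types (g : nat -> R) (c : R).
Local Open Scope ereal_scope.

Let den c (k : nat) : R := ((k.+1%:R - 2^-1) ^+ 2 + c ^+ 2 / (4 * pi ^+ 2))%R.

Let den0_ge k : (4^-1 <= den 0 k)%R.
Proof.
rewrite /den expr0n/= mul0r addr0.
have : (0 <= k%:R :> R)%R by [].
move=> k0; have h : (2^-1 <= k.+1%:R - 2^-1 :> R)%R by rewrite -[k.+1%:R]natr1; lra.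
have -> : (4^-1 = 2^-1 ^+ 2 :> R)%R by field.
by rewrite ler_pXn2r// nnegrE; lra.
Qed.

Let pi2 : (0 < pi ^+ 2 :> R)%R. Proof. by rewrite exprn_gt0// pi_gt0. Qed.

Let den0_le c k : (den 0 k <= den c k)%R.
Proof.
rewrite /den expr0n/= mul0r addr0 lerDl divr_ge0 ?sqr_ge0// mulr_ge0//.
exact: ltW.
Qed.

Let den_gt0 c k : (0 < den c k)%R.
Proof. by rewrite (lt_le_trans _ (den0_le c k))// (lt_le_trans _ (den0_ge k))// invr_gt0. Qed.

(** As [den 0 k >= 1/4], the term [c^2 / (4 pi^2)] is at most a fixed multiple of [den 0 k]. So the
    series at [c] and at 0 converge or diverge together. *)
Let den_le c k : (den c k <= (1 + c ^+ 2 / pi ^+ 2) * den 0 k)%R.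
Proof.
have -> : (den c k = den 0 k + (c ^+ 2 / pi ^+ 2) * 4^-1)%R.
  by rewrite /den expr0n/= mul0r addr0 invfM [(4^-1 * _)%R]mulrC mulrA.
rewrite mulrDl mul1r lerD2l ler_wpM2l ?den0_ge// divr_ge0 ?sqr_ge0//.
Qed.

Lemma polya_gamma_sum_ge0 g c : (forall k, 0 <= g k)%R -> (0 <= polya_gamma_sum g c)%R.
Proof.
move=> g0; rewrite mulr_ge0//; first by rewrite invr_ge0 mulr_ge0// ltW.
rewrite fine_ge0// nneseries_ge0// => k _ _.
by rewrite lee_fin divr_ge0// ltW// den_gt0.
Qed.

(* If the series diverges at [0] it diverges at [c], where [fine] gives [0]. *)
Lemma polya_gamma_sum_le0 g c : (forall k, 0 <= g k)%R ->
  (polya_gamma_sum g c <= polya_gamma_sum g 0)%R.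
Proof.
move=> g0; rewrite /polya_gamma_sum ler_wpM2l//; first by rewrite invr_ge0 mulr_ge0// ltW.
pose S c := \sum_(0 <= k <oo) (g k / den c k)%:E.
rewrite -/(S c) -/(S 0%R).
have t0 e k : 0 <= (g k / den e k)%:E by rewrite lee_fin divr_ge0// ltW.
have S0 e : 0 <= S e by apply: nneseries_ge0 => k _ _.
have le1 : S c <= S 0%R.
  by apply: lee_nneseries => [k _ _//|k _]; rewrite lee_fin ler_wpM2l// lef_pV2// posrE den_gt0.
have le2 : S 0%R <= (1 + c ^+ 2 / pi ^+ 2)%:E * S c.
  rewrite -nneseriesZl; last by move=> k _.
  apply: lee_nneseries => [k _ _//|k _]; rewrite -EFinM lee_fin mulrCA ler_wpM2l//.
  by rewrite ler_pdivlMr// ler_pdivrMl// mulrC den_le.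
move: (S0 c) (S0 0%R) le1 le2; case: (S c) => [x||]//; case: (S _) => [y||]//=.
Qed.

Lemma measurable_polya_gamma_sum d (T : measurableType d) (g : nat -> T -> R) (c : T -> R) :
  (forall k x, 0 <= g k x)%R -> (forall k, measurable_fun setT (g k)) ->
  measurable_fun setT c ->
  measurable_fun setT (fun x => polya_gamma_sum (g ^~ x) (c x)).
Proof.
move=> g0 mg mc; apply: measurable_funM => //.
apply: measurableT_comp; first exact: fine_measurable.
have := @ge0_emeasurable_sum _ _ _ setT (fun k x => (g k x / den (c x) k)%:E) xpredT.
apply.
  by move=> k x _ _; rewrite lee_fin divr_ge0// ltW.
move=> k _; apply/measurable_EFinP; apply: measurable_funM => //.
apply: measurableT_comp; first exact: measurable_inv_fun.
apply: measurable_funD => //; apply: measurable_funM => //.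
exact: measurable_funX.
Qed.

End polya_gamma.

(** Only the laws of the [g j] are prescribed, so negative values are merely improbable; over all
    indices they occupy a countable union of null events. *)
Lemma iid_exponential_ge0 d (T : measurableType d) (R : realType)
    (P : probability T R) n (g : 'I_n * nat -> {RV P >-> R}) : iid_exponential g ->
  exists N, [/\ measurable N, P N = 0%E & forall x, ~ N x -> forall j, 0 <= g j x].
Proof.
move=> [_ glaw].
have gneg j : P (g j @^-1` `]-oo, 0[) = 0%E.
  rewrite glaw//; rewrite /exponential_prob integral0_eq// => x /=.
  rewrite in_itv/= /exponential_pdf patchE => x0.
  by rewrite ifF// mem_setE in_itv/= andbT; apply/negbTE; rewrite -ltNge.
pose N := \bigcup_k \big[setU/set0]_(i < n) (g (i, k) @^-1` `]-oo, 0[).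
have mg j : measurable (g j @^-1` `]-oo, 0[).
  by rewrite -[X in measurable X]setTI; exact: measurable_funPT.
have mN : measurable N by apply: bigcupT_measurable => k; exact: bigsetU_measurable.
exists N; split => //.
  apply/negligibleP => //; apply: negligible_bigcup => k.
  elim/big_ind: _ => [||i _]; [exact: negligible_set0|exact: negligibleU|].
  by apply/negligibleP; [exact: mg|exact: gneg].
move=> x Nx [i k]; rewrite leNgt; apply/negP => gx; apply: Nx; exists k => //.
by rewrite -bigcup_seq; exists i => //=; exact: mem_index_enum.
Qed.

(** * The Gaussian conditional law *)

Section measurable_matrix.
Context d (T : measurableType d) (R : realType).

(** Entrywise, in place of a sigma-algebra on matrices. *)
Definition mx_measurable m n (A : T -> 'M[R]_(m, n)) :=
  forall i j, measurable_fun setT (fun x => A x i j).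

Lemma mx_measurable_cst m n (A : 'M[R]_(m, n)) : mx_measurable (fun=> A).
Proof. by move=> i j; exact: measurable_cst. Qed.

Lemma mx_measurableD m n (A B : T -> 'M[R]_(m, n)) :
  mx_measurable A -> mx_measurable B -> mx_measurable (fun x => A x + B x).
Proof.
move=> mA mB i j; under eq_fun do rewrite mxE.
exact: measurable_funD.
Qed.

Lemma mx_measurableB m n (A B : T -> 'M[R]_(m, n)) :
  mx_measurable A -> mx_measurable B -> mx_measurable (fun x => A x - B x).
Proof.
move=> mA mB i j; under eq_fun do rewrite !mxE.
exact: measurable_funB.
Qed.

Lemma mx_measurableZ m n (c : T -> R) (A : T -> 'M[R]_(m, n)) :
  measurable_fun setT c -> mx_measurable A -> mx_measurable (fun x => c x *: A x).
Proof.
move=> mc mA i j; under eq_fun do rewrite mxE.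
exact: measurable_funM.
Qed.

Lemma mx_measurableM m n q (A : T -> 'M[R]_(m, n)) (B : T -> 'M[R]_(n, q)) :
  mx_measurable A -> mx_measurable B -> mx_measurable (fun x => A x *m B x).
Proof.
move=> mA mB i j; under eq_fun do rewrite mxE.
by apply: measurable_sum => k; exact: measurable_funM.
Qed.

Lemma mx_measurable_tr m n (A : T -> 'M[R]_(m, n)) :
  mx_measurable A -> mx_measurable (fun x => (A x)^T).
Proof. by move=> mA i j; under eq_fun do rewrite mxE; exact: mA. Qed.

Lemma measurable_det n (A : T -> 'M[R]_n) :
  mx_measurable A -> measurable_fun setT (fun x => \det (A x)).
Proof.
move=> mA; apply: measurable_sum => s; apply: measurable_funM => //.
by apply: measurable_prod => i _; exact: mA.
Qed.

(** Cramer's formula where the determinant is nonzero; [invmx] leaves a singular matrix unchanged,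
    hence the case split. *)
Lemma mx_measurable_inv n (A : T -> 'M[R]_n) :
  mx_measurable A -> mx_measurable (fun x => invmx (A x)).
Proof.
move=> mA i j.
have mdet := measurable_det mA.
rewrite (_ : (fun x => _) = (fun x => if \det (A x) == 0 then A x i j
    else (\det (A x))^-1 * cofactor (A x) j i)); last first.
  apply/funext => x; rewrite /invmx unitmxE unitfE.
  by case: eqP => _ //=; rewrite !mxE.
apply: measurable_fun_ifT => //.
- apply: (measurable_fun_eqr mdet); exact: measurable_cst.
- apply: measurable_funM; first exact: measurableT_comp measurable_inv_fun mdet.
  apply: measurable_funM => //; apply: measurable_det => k l.
  by under eq_fun do rewrite !mxE; exact: mA.
Qed.

End measurable_matrix.

(** * Bounds on the quadratic form of the precision matrix *)

Section precision_form.
Context {R : realType}.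
Variables (n p : nat) (X : 'M[R]_(n, p)) (y : 'I_n -> bool) (zeta : R).
Hypothesis zeta_gt0 : 0 < zeta.
Implicit Types (w : n.-tuple R) (l : p.-tuple R) (t : R) (z : 'cV[R]_p).

Definition qform w l t z : R :=
  \sum_i tnth w i * ((X *m z) i 0) ^+ 2 + zeta ^- 2 * \sum_j z j 0 ^+ 2 +
  t ^- 2 * \sum_j tnth l j ^- 2 * z j 0 ^+ 2.

Lemma diag_form m (v : 'cV[R]_m) (D : 'rV[R]_m) :
  (v^T *m diag_mx D *m v) 0 0 = \sum_i D 0 i * v i 0 ^+ 2.
Proof.
rewrite mxE; apply: eq_bigr => i _.
by rewrite mul_mx_diag !mxE; ring.
Qed.

Lemma precision_form w l t z :
  (z^T *m precision X zeta w l t *m z) 0 0 = qform w l t z.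
Proof.
rewrite /precision /qform !mulmxDr !mulmxDl.
rewrite [LHS]mxE [X in X + _]mxE; congr (_ + _ + _).
- rewrite !mulmxA -mulmxA -trmx_mul diag_form.
  by apply: eq_bigr => i _; rewrite !mxE.
- rewrite mul_mx_scalar -scalemxAl mxE; congr (_ * _).
  by rewrite mxE; apply: eq_bigr => j _; rewrite mxE expr2.
- rewrite -scalemxAr -scalemxAl mxE; congr (_ * _).
  by rewrite diag_form; apply: eq_bigr => j _; rewrite mxE.
Qed.

Lemma qform_ge w l t z : (forall i, 0 <= tnth w i) ->
  zeta ^- 2 * \sum_j z j 0 ^+ 2 <= qform w l t z.
Proof.
move=> w0; rewrite /qform -addrAC lerDr addr_ge0//.
  by apply: sumr_ge0 => i _; rewrite mulr_ge0 ?sqr_ge0.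
rewrite mulr_ge0 ?invr_ge0 ?sqr_ge0//.
by apply: sumr_ge0 => i _; rewrite mulr_ge0 ?invr_ge0 ?sqr_ge0.
Qed.

(** [(u - v)^2 <= 2 u^2 + 2 v^2] in each square; it separates the point from the posterior mean in
    the Gaussian exponent. *)
Lemma qformB w l t z1 z2 : (forall i, 0 <= tnth w i) ->
  qform w l t (z1 - z2) <= 2 * qform w l t z1 + 2 * qform w l t z2.
Proof.
move=> w0.
have sq (u v : R) : (u - v) ^+ 2 <= 2 * u ^+ 2 + 2 * v ^+ 2.
  by rewrite -subr_ge0 [leRHS](_ : _ = (u + v) ^+ 2) ?sqr_ge0//; ring.
have sumsq m (c u v : 'I_m -> R) : (forall i, 0 <= c i) ->
    \sum_i c i * (u i - v i) ^+ 2 <=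
    2 * \sum_i c i * u i ^+ 2 + 2 * \sum_i c i * v i ^+ 2.
  move=> c0; rewrite !mulr_sumr -big_split; apply: ler_sum => i _ /=.
  rewrite [leRHS](_ : _ = c i * (2 * u i ^+ 2 + 2 * v i ^+ 2)); last by ring.
  exact: ler_wpM2l.
rewrite /qform.
have h1 := sumsq _ (tnth w) (fun i => (X *m z1) i 0) (fun i => (X *m z2) i 0) w0.
have h2 := sumsq _ (fun=> 1) (fun j => z1 j 0) (fun j => z2 j 0) (fun=> ler01).
have h3 := sumsq _ (fun j => tnth l j ^- 2) (fun j => z1 j 0) (fun j => z2 j 0)
  (fun j => ltac:(by rewrite invr_ge0 sqr_ge0)).
move: h2; under eq_bigr do rewrite mul1r.
under [X in _ <= 2 * X + _]eq_bigr do rewrite mul1r.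
under [X in _ <= _ + 2 * X]eq_bigr do rewrite mul1r.
move=> h2.
under eq_bigr do rewrite mulmxBr mxE [X in _ + X]mxE.
under [X in _ + _ * X + _]eq_bigr do rewrite mxE [X in _ + X]mxE.
under [X in _ + _ * X <= _]eq_bigr do rewrite mxE [X in _ + X]mxE.
have z2' : 0 <= zeta ^- 2 by rewrite invr_ge0 sqr_ge0.
have t2' : 0 <= t ^- 2 by rewrite invr_ge0 sqr_ge0.
have {h2} := ler_wpM2l z2' h2; have {h3} := ler_wpM2l t2' h3.
by lra.
Qed.

Lemma precision_unit w l t : (forall i, 0 <= tnth w i) ->
  precision X zeta w l t \in unitmx.
Proof.
move=> w0; rewrite unitmxE unitfE; apply/det0P => -[v v0 vP].
move/eqP: v0; apply.
have := qform_ge l t v^T w0; rewrite -precision_form trmxK vP mul0mx mxE.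
rewrite pmulr_rle0 ?invr_gt0 ?exprn_gt0// => s0.
have /eqP : \sum_j v^T j 0 ^+ 2 = 0.
  by apply/eqP; rewrite eq_le s0 sumr_ge0// => j _; rewrite sqr_ge0.
rewrite psumr_eq0; last by move=> j _; rewrite sqr_ge0.
move=> /allP h; apply/rowP => j; rewrite mxE.
by have := h j (mem_index_enum _); rewrite sqrf_eq0 mxE => /eqP.
Qed.

Definition score : 'cV[R]_p := X^T *m \col_i ((y i)%:R - 2^-1).

Definition post_mean w l t : 'cV[R]_p :=
  invmx (precision X zeta w l t) *m X^T *m \col_i ((y i)%:R - 2^-1).

(** The precision maps the mean to [score], so the form at the mean is a scalar product with
    [score]. Young's inequality, scaled by [zeta], bounds it by half of itself plus half of the
    right-hand side. *)
Lemma qform_post_mean w l t : (forall i, 0 <= tnth w i) ->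
  qform w l t (post_mean w l t) <= zeta ^+ 2 * \sum_j score j 0 ^+ 2.
Proof.
move=> w0; set mu := post_mean w l t.
have muE : qform w l t mu = \sum_j mu j 0 * score j 0.
  rewrite -precision_form -mulmxA {2}/mu /post_mean -!mulmxA mulKVmx ?precision_unit//.
  by rewrite mxE; apply: eq_bigr => j _; rewrite mxE.
have h1 := qform_ge l t mu w0.
have h2 : \sum_j mu j 0 * score j 0 <=
   2^-1 * (zeta ^- 2 * \sum_j mu j 0 ^+ 2) + 2^-1 * (zeta ^+ 2 * \sum_j score j 0 ^+ 2).
  rewrite !mulr_sumr -big_split; apply: ler_sum => j _ /=.
  rewrite -subr_ge0 [leRHS](_ : _ = 2^-1 * (zeta^-1 * mu j 0 - zeta * score j 0) ^+ 2).
    by rewrite mulr_ge0 ?sqr_ge0.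
  by field; rewrite gt_eqF.
rewrite -muE in h2; lra.
Qed.

(** The largest values of the three parts of [qform] on the unit box are bounded separately; there
    [|x_i^T z|] is at most the sum of the [|X i j|]. *)
Definition box_bound w l t : R :=
  \sum_i tnth w i * (\sum_j `|X i j|) ^+ 2 + zeta ^- 2 * p%:R +
  t ^- 2 * \sum_j tnth l j ^- 2.

Lemma qform_box w l t z : (forall i, 0 <= tnth w i) -> (forall j, 0 <= z j 0 <= 1) ->
  qform w l t z <= box_bound w l t.
Proof.
move=> w0 z01.
have zsq j : z j 0 ^+ 2 <= 1 by have := z01 j; nra.
rewrite /qform /box_bound !lerD//.
- apply: ler_sum => i _; rewrite ler_wpM2l// -[leLHS]real_normK ?num_real//.
  rewrite ler_pXn2r// ?nnegrE ?sumr_ge0//.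
  rewrite mxE (le_trans (ler_norm_sum _ _ _))//; apply: ler_sum => j _.
  rewrite normrM ler_piMr// ger0_norm; by have /andP[] := z01 j.
- rewrite ler_wpM2l ?invr_ge0 ?sqr_ge0//.
  by rewrite (le_trans (ler_sum _ (fun j _ => zsq j)))// sumr_const card_ord.
- rewrite ler_wpM2l ?invr_ge0 ?sqr_ge0//.
  by apply: ler_sum => j _; rewrite ler_piMr ?invr_ge0 ?sqr_ge0.
Qed.

End precision_form.

(** * Normalization and lower bound of the Gaussian density *)

Section gaussian_density.
Context {R : realType}.
Variables (n p : nat) (X : 'M[R]_(n, p)) (y : 'I_n -> bool) (zeta : R).
Hypothesis zeta_gt0 : 0 < zeta.
Notation leb := (@lebesgue_measure R).
Notation lebp := (@lebesgue_tuple R p).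

Let num w l t (z : p.-tuple R) : R :=
  expR (- 2^-1 * qform X zeta w l t (colv z - post_mean X y zeta w l t)).

Let Z w l t := fine (\int[lebp]_z (num w l t z)%:E).

(** [invmx] is an involution on all square matrices, singular ones included, so this form holds for
    arbitrary weights. *)
Lemma beta_densityE w l t z : beta_density X y zeta w l t z = num w l t z / Z w l t.
Proof.
rewrite /beta_density /mvnormal_pdf /normalized /Z invmxK; congr (_ / fine _).
  by rewrite precision_form.
by apply: eq_integral => b _; rewrite precision_form.
Qed.

Section joint_measurability.
Context d (T : measurableType d).
Variables (w : T -> n.-tuple R) (l : T -> p.-tuple R) (t : T -> R).
Hypotheses (mw : measurable_fun setT w) (ml : measurable_fun setT l)
  (mt : measurable_fun setT t).

Let mx_measurable_precision :
  mx_measurable (fun x => precision X zeta (w x) (l x) (t x)).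
Proof.
apply: mx_measurableD.
  apply: mx_measurableD; last exact: mx_measurable_cst.
  apply: mx_measurableM; last exact: mx_measurable_cst.
  apply: mx_measurableM; first exact: mx_measurable_cst.
  move=> i j; under eq_fun do rewrite !mxE.
  case: (i == j); last by under eq_fun do rewrite mulr0n; exact: measurable_cst.
  under eq_fun do rewrite mulr1n.
  exact: measurableT_comp (measurable_tnth i) mw.
apply: mx_measurableZ.
  by apply: measurableT_comp; [exact: measurable_inv_fun|exact: measurable_funX].
move=> i j; under eq_fun do rewrite !mxE.
case: (i == j); last by under eq_fun do rewrite mulr0n; exact: measurable_cst.
under eq_fun do rewrite mulr1n.
apply: measurableT_comp; first exact: measurable_inv_fun.
by apply: measurable_funX; exact: measurableT_comp (measurable_tnth i) ml.
Qed.

Lemma measurable_num (z : T -> p.-tuple R) : measurable_fun setT z ->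
  measurable_fun setT (fun x => num (w x) (l x) (t x) (z x)).
Proof.
move=> mz.
have mv : mx_measurable (fun x => colv (z x) - post_mean X y zeta (w x) (l x) (t x)).
  apply: mx_measurableB.
    move=> i j; under eq_fun do rewrite mxE.
    exact: measurableT_comp (measurable_tnth i) mz.
  apply: mx_measurableM; last exact: mx_measurable_cst.
  apply: mx_measurableM; last exact: mx_measurable_cst.
  exact: mx_measurable_inv.
apply: measurableT_comp => //; apply: measurable_funM => //.
under eq_fun do rewrite -precision_form.
have := mx_measurableM (mx_measurableM (mx_measurable_tr mv) mx_measurable_precision) mv.
exact.
Qed.

End joint_measurability.

Let mnum w l t : measurable_fun setT (num w l t).
Proof. by apply: (@measurable_num _ _ (cst w) (cst l) (cst t) _ _ _ id). Qed.

Let num_gt0 w l t z : 0 < num w l t z. Proof. exact: expR_gt0. Qed.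

Lemma measurable_beta_density d (T : measurableType d)
    (w : T -> n.-tuple R) (l : T -> p.-tuple R) (t : T -> R) :
  measurable_fun setT w -> measurable_fun setT l -> measurable_fun setT t ->
  measurable_fun setT (fun x : T * p.-tuple R =>
    beta_density X y zeta (w x.1) (l x.1) (t x.1) x.2).
Proof.
move=> mw ml mt; under eq_fun do rewrite beta_densityE.
have m1 : measurable_fun setT (fun x : T * p.-tuple R =>
    num (w x.1) (l x.1) (t x.1) x.2).
  by apply: measurable_num; [exact: measurableT_comp mw measurable_fst|
    exact: measurableT_comp ml measurable_fst|
    exact: measurableT_comp mt measurable_fst|exact: measurable_snd].
apply: measurable_funM => //; apply: measurableT_comp; first exact: measurable_inv_fun.
apply: measurableT_comp; first exact: fine_measurable.
have mZ : measurable_fun setT (fun x => \int[lebp]_z (num (w x) (l x) (t x) z)%:E)%E.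
  apply: (@measurable_fun_fubini_tonelli_F _ _ _ _ _ lebp
    (fun x : T * p.-tuple R => (num (w x.1) (l x.1) (t x.1) x.2)%:E)).
    exact/measurable_EFinP.
  by move=> x; rewrite lee_fin ltW.
exact: measurableT_comp mZ measurable_fst.
Qed.

Lemma integral_normal_fun (m : R) :
  (\int[leb]_x (normal_fun m zeta x)%:E = ((normal_peak zeta)^-1)%:E)%E.
Proof.
have z0 : zeta != 0 by rewrite gt_eqF.
have pk : 0 < normal_peak zeta by exact: normal_peak_gt0.
have := integral_normal_pdf m zeta; rewrite normal_pdfE//.
under eq_integral do rewrite EFinM.
rewrite ge0_integralZl//; last 3 first.
- by apply/measurable_EFinP; exact: measurable_normal_fun.
- by move=> x _; rewrite lee_fin normal_fun_ge0.
- by rewrite lee_fin ltW.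
move=> h; have -> : ((normal_peak zeta)^-1%:E = (normal_peak zeta)^-1%:E * 1)%E by rewrite mule1.
by rewrite -h muleA -EFinM mulVf ?gt_eqF// mul1e.
Qed.

Definition box : set (p.-tuple R) :=
  [set z | forall j, (`[0, 1]%classic : set R) (tnth z j)].

Lemma measurable_box : measurable box.
Proof. exact: measurable_tuple_all. Qed.

Lemma lebesgue_box : lebp box = 1%E.
Proof.
rewrite -[LHS]mul1e -(integral_cst lebp measurable_box 1%E).
transitivity (\int[lebp]_(z in box) (\prod_(j < p) (fun=> 1 : R) (tnth z j))%:E)%E.
  by apply: eq_integral => z _; rewrite big1.
rewrite (integral_lebesgue_tuple_prod_on (f := fun _ _ => 1 : R))//.
apply: big1 => j _; rewrite [LHS]integral_cst// mul1e.
by apply: etrans (lebesgue_measure_itv `[0%R, 1%R]) _; rewrite /= lte_fin ltr01 oppr0 adde0.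
Qed.

(** This is [(2 pi zeta^2)^(p/2)], the normalizer of a normal law with covariance [zeta^2] times the
    identity. In [low] the 2 of [qformB] has cancelled the 1/2 of the Gaussian exponent. *)
Let Cz : R := (normal_peak zeta)^-1 ^+ p.
Let Cv : R := zeta ^+ 2 * \sum_j score X y j 0 ^+ 2.
Let low w l t : R := expR (- (box_bound X zeta w l t + Cv)).

Lemma gaussian_const_gt0 : 0 < Cz.
Proof. by rewrite exprn_gt0// invr_gt0 normal_peak_gt0// gt_eqF. Qed.

Section positive_weights.
Variables (w : n.-tuple R) (l : p.-tuple R) (t : R).
Hypothesis w0 : forall i, 0 <= tnth w i.

Let low_num z : box z -> low w l t <= num w l t z.
Proof.
move=> zb; rewrite ler_expR.
have zb' j : 0 <= colv z j 0 <= 1 by rewrite mxE; have := zb j; rewrite /= in_itv.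
have h1 := qform_box X zeta l t w0 zb'.
have h2 := qform_post_mean X y zeta_gt0 l t w0.
have h3 := qformB X zeta l t (colv z) (post_mean X y zeta w l t) w0.
rewrite -/Cv in h2; lra.
Qed.

Let num_le z : num w l t z <= \prod_(j < p) normal_fun (post_mean X y zeta w l t j 0) zeta (tnth z j).
Proof.
rewrite /normal_fun -expR_sum ler_expR.
apply: (@le_trans _ _ (- 2^-1 * (zeta ^- 2 *
    \sum_j (colv z - post_mean X y zeta w l t) j 0 ^+ 2))).
  by rewrite !mulNr lerN2 ler_wpM2l//; exact: qform_ge.
rewrite !mulr_sumr; apply: ler_sum => j _; rewrite !mxE -mulr_natr.
by rewrite le_eqVlt; apply/orP; left; apply/eqP; field; rewrite gt_eqF.
Qed.

Let intZ_le : (\int[lebp]_z (num w l t z)%:E <= Cz%:E)%E.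
Proof.
have mprod : measurable_fun setT (fun z : p.-tuple R => \prod_(j < p)
    (normal_fun (post_mean X y zeta w l t j 0) zeta (tnth z j))%:E)%E.
  apply: emeasurable_prod => j; apply/measurable_EFinP.
  exact: measurableT_comp (measurable_normal_fun _ _) (measurable_tnth j).
apply: (@le_trans _ _ (\int[lebp]_z \prod_(j < p)
    (normal_fun (post_mean X y zeta w l t j 0) zeta (tnth z j))%:E)%E).
  apply: ge0_le_integral => //.
  - by move=> z _; rewrite lee_fin ltW.
  - exact/measurable_EFinP.
  - by move=> z _; rewrite prodEFin lee_fin num_le.
rewrite (integral_lebesgue_tuple_prod (f := fun j => EFin \o normal_fun (post_mean X y zeta w l t j 0) zeta)).
- under eq_bigr do rewrite integral_normal_fun.
  by rewrite prodEFin prodr_const card_ord.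
- by move=> j; apply/measurable_EFinP; exact: measurable_normal_fun.
- by move=> j x; rewrite lee_fin normal_fun_ge0.
Qed.

Let low_le_intZ : ((low w l t)%:E <= \int[lebp]_z (num w l t z)%:E)%E.
Proof.
apply: (@le_trans _ _ (\int[lebp]_(z in box) (low w l t)%:E)%E).
  rewrite (integral_cst lebp measurable_box (low w l t)%:E).
  by rewrite [X in (_ <= _ * X)%E](_ : _ = 1%E) ?mule1//; exact: lebesgue_box.
apply: (@le_trans _ _ (\int[lebp]_(z in box) (num w l t z)%:E)%E).
  apply: ge0_le_integral => //; first exact: measurable_box.
  - by move=> z _; rewrite lee_fin expR_ge0.
  - exact/measurable_EFinP/measurable_funTS.
apply: ge0_subset_integral => //; first exact: measurable_box.
- exact/measurable_EFinP.
- by move=> z _; rewrite lee_fin ltW.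
Qed.

Let intZ : (\int[lebp]_z (num w l t z)%:E)%E = (Z w l t)%:E.
Proof.
rewrite fineK// ge0_fin_numE; last first.
  by apply: le_trans low_le_intZ; rewrite lee_fin expR_ge0.
exact: le_lt_trans intZ_le (ltry _).
Qed.

(** Above, the precision is at least [zeta^-2], so the integrand is below a product of normal
    functions of scale [zeta]. Below, it is at least [low] on the unit box, which has volume 1. *)
Lemma normalizer_bounds : 0 < Z w l t <= Cz.
Proof.
rewrite -lee_fin -intZ intZ_le andbT -lte_fin -intZ.
by apply: lt_le_trans low_le_intZ; rewrite lte_fin expR_gt0.
Qed.

Lemma beta_density_prob : (\int[lebp]_z (beta_density X y zeta w l t z)%:E = 1)%E.
Proof.
under eq_integral do rewrite beta_densityE mulrC EFinM.
have /andP[Z0 _] := normalizer_bounds.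
rewrite ge0_integralZl//.
- by rewrite intZ -EFinM mulVf// gt_eqF.
- exact/measurable_EFinP.
- by move=> z _; rewrite lee_fin ltW.
- by rewrite lee_fin invr_ge0 ltW.
Qed.

Lemma beta_density_box z : box z ->
  expR (- (box_bound X zeta w l t + Cv)) / Cz <= beta_density X y zeta w l t z.
Proof.
move=> zb; rewrite beta_densityE.
have /andP[Z0 ZC] := normalizer_bounds.
rewrite ler_pM ?expR_ge0 ?invr_ge0 ?(ltW gaussian_const_gt0)//; first exact: low_num.
by rewrite lef_pV2// posrE gaussian_const_gt0.
Qed.

End positive_weights.

Lemma beta_density_ge0 w l t z : 0 <= beta_density X y zeta w l t z.
Proof.
rewrite beta_densityE divr_ge0 ?expR_ge0// fine_ge0// integral_ge0// => x _.
by rewrite lee_fin expR_ge0.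
Qed.

End gaussian_density.

(** * The global scale *)

Section integral_monotonicity.
Context d (T : measurableType d) (R : realType) (mu : {measure set T -> \bar R}).
Local Open Scope ereal_scope.
Import HBNNSimple.

(* No measurability is required: the integral of a nonnegative function is the
   supremum of the integrals of the simple functions below it. *)
Lemma ge0_le_integral_subset (D1 D2 : set T) (f1 f2 : T -> \bar R) :
  D1 `<=` D2 -> (forall x, D1 x -> 0 <= f1 x) -> (forall x, D2 x -> 0 <= f2 x) ->
  (forall x, D1 x -> f1 x <= f2 x) ->
  \int[mu]_(x in D1) f1 x <= \int[mu]_(x in D2) f2 x.
Proof.
move=> D12 f10 f20 f12; rewrite integral_mkcond [leRHS]integral_mkcond.
have r1 x : 0 <= (f1 \_ D1) x by apply: erestrict_ge0.
have r2 x : 0 <= (f2 \_ D2) x by apply: erestrict_ge0.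
rewrite !ge0_integralTE//; apply: ereal_sup_le => _ [h hf <-]; exists h => // x; apply: (le_trans (hf x)); rewrite !patchE.
case: ifPn => [/[!inE] D1x|_]; last by case: ifPn => // /[!inE]; exact: f20.
by rewrite ifT ?f12// inE; exact: D12.
Qed.

End integral_monotonicity.

Section tau_step.
Context {R : realType}.
Variables (p : nat) (a : R) (pi_glo : probability R R) (tau_min : R).
Hypotheses (tau_gt0 : 0 < tau_min) (pi_glo1 : pi_glo `[tau_min, +oo[%classic = 1%E).
Local Open Scope ereal_scope.

Let tw (b : p.-tuple R) (t : R) : R :=
  (t ^- p * \prod_(j < p) expR (- (`|tnth b j / t| `^ a)))%R.

Let tw_gt0 b t : (0 < t)%R -> (0 < tw b t)%R.
Proof.
move=> t0; rewrite mulr_gt0 ?invr_gt0 ?exprn_gt0//.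
by apply: prodr_gt0 => j _; exact: expR_gt0.
Qed.

Let tw_le b t : (tau_min <= t)%R -> (tw b t <= tau_min ^- p)%R.
Proof.
move=> taut; have t0 := lt_le_trans tau_gt0 taut.
rewrite -[leRHS]mulr1 ler_pM ?invr_ge0 ?exprn_ge0 ?(ltW t0)//.
- by apply: prodr_ge0 => j _; exact: expR_ge0.
- rewrite lef_pV2 ?posrE ?exprn_gt0// lerXn2r// nnegrE ltW//.
- by apply: prodr_ile1 => j _; rewrite expR_ge0 -expR0 ler_expR oppr_le0 powR_ge0.
Qed.

Let measurable_tw d (T : measurableType d) (b : T -> p.-tuple R) (t : T -> R) :
  measurable_fun setT b -> measurable_fun setT t ->
  measurable_fun setT (fun x => tw (b x) (t x)).
Proof.
move=> mb mt; apply: measurable_funM.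
  by apply: measurableT_comp; [exact: measurable_inv_fun|exact: measurable_funX].
apply: measurable_prod => j _; apply: measurableT_comp => //; apply: measurableT_comp => //.
apply: (measurableT_comp (measurable_powR a)); apply: measurableT_comp => //.
apply: measurable_funM; first exact: measurableT_comp (measurable_tnth j) mb.
exact: measurableT_comp measurable_inv_fun mt.
Qed.

Let mtw b : measurable_fun setT (tw b).
Proof. exact: (@measurable_tw _ _ (cst b) id). Qed.

Let N b := \int[pi_glo]_(t in `]0%R, +oo[) (tw b t)%:E.

Let sub_tau : (`[tau_min, +oo[%classic : set R) `<=` `]0%R, +oo[%classic.
Proof. by apply: subset_itvr; rewrite bnd_simp. Qed.

Let itv0P t : (`]0%R, +oo[%classic : set R) t -> (0 < t)%R.
Proof. by rewrite /= in_itv/= andbT. Qed.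

Let integral_tau (f : R -> \bar R) : measurable_fun (`]0%R, +oo[%classic : set R) f ->
  (forall t, (0 < t)%R -> 0 <= f t) ->
  \int[pi_glo]_(t in `]0%R, +oo[) f t = \int[pi_glo]_(t in `[tau_min, +oo[) f t.
Proof.
move=> mf f0.
have N0 : pi_glo (~` `[tau_min, +oo[%classic) = 0.
  by rewrite probability_setC// pi_glo1 subee.
rewrite (ge0_negligible_integral (N := ~` `[tau_min, +oo[%classic))//; last 2 first.
- exact: measurableC.
- by move=> t /itv0P/f0.
congr (integral _ _ _); rewrite setDE setCK.
by apply/setIidPr.
Qed.

(** On [[tau_min, +oo[] the weight is at most [tau_min^-p], which gives finiteness. It is strictly
    positive there, and the prior has mass 1 on this set: a zero integral would make the weight
    vanish almost everywhere. *)
Let N_bounds b : 0 < N b < +oo.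
Proof.
have mE : measurable_fun setT (fun t => (tw b t)%:E) by exact/measurable_EFinP.
rewrite /N integral_tau; last 2 first.
- exact: measurable_funTS.
- by move=> t /tw_gt0/ltW; rewrite lee_fin.
apply/andP; split.
  rewrite lt_neqAle eq_sym integral_ge0 ?andbT; last first.
    by move=> t /sub_tau/itv0P/tw_gt0/ltW; rewrite lee_fin.
  apply/eqP => I0.
  have : \int[pi_glo]_(t in `[tau_min, +oo[) `|(tw b t)%:E| = 0.
    rewrite -[RHS]I0; apply: eq_integral => t /[!inE] /sub_tau/itv0P/tw_gt0 t0.
    by rewrite gee0_abs// lee_fin ltW.
  move/(ae_eq_integral_abs _ _ _).1 => /(_ _ _)[]//.
  - exact: measurable_funTS.
  move=> A [mA A0 sA].
  have : pi_glo `[tau_min, +oo[%classic <= pi_glo A.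
    apply: le_measure; rewrite ?inE// => t tt; apply: sA => /= /(_ tt)[] tw0.
    by have := tw_gt0 b (itv0P (sub_tau tt)); rewrite tw0 ltxx.
  by rewrite pi_glo1 A0 lee_fin ler10.
apply: (@le_lt_trans _ _ (\int[pi_glo]_(t in `[tau_min, +oo[) (tau_min ^- p)%:E)).
  apply: ge0_le_integral_subset => //.
  - by move=> t /sub_tau/itv0P/tw_gt0/ltW; rewrite lee_fin.
  - by move=> t _; rewrite lee_fin invr_ge0 exprn_ge0// ltW.
  - by move=> t /=; rewrite in_itv/= andbT lee_fin => /tw_le.
by rewrite integral_cst// [X in _ * X](_ : _ = 1) ?mule1 ?ltry//; exact: pi_glo1.
Qed.

Let NE b : N b = (fine (N b))%:E.
Proof.
by have /andP[N0 Noo] := N_bounds b; rewrite fineK// ge0_fin_numE// ltW.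
Qed.

Let fN_gt0 b : (0 < fine (N b))%R.
Proof. by have /andP[N0 _] := N_bounds b; rewrite -lte_fin -NE. Qed.

Lemma tau_density_ge0 (b : p.-tuple R) t : (0 < t)%R -> (0 <= tau_density a pi_glo b t)%R.
Proof. by move=> /(tw_gt0 b) t0; rewrite divr_ge0// ltW//; exact: fN_gt0. Qed.

Lemma measurable_tau_density :
  measurable_fun setT (fun x : p.-tuple R * R => tau_density a pi_glo x.1 x.2).
Proof.
have mN : measurable_fun setT N.
  rewrite (_ : N = fun b => \int[pi_glo]_t (tw b t * \1_(`]0%R, +oo[%classic : set R) t)%:E).
    apply: (@measurable_fun_fubini_tonelli_F _ _ _ _ _ pi_glo
      (fun x : p.-tuple R * R => (tw x.1 x.2 * \1_(`]0%R, +oo[%classic : set R) x.2)%:E)).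
      apply/measurable_EFinP; apply: measurable_funM; first exact: measurable_tw.
      exact: measurableT_comp (measurable_indic _) measurable_snd.
    move=> [b t]; rewrite lee_fin indicE /=; case: (boolP (_ \in _)) => [/[!inE]|_].
      by move=> /itv0P/(tw_gt0 b)/ltW; rewrite mulr1.
    by rewrite mulr0.
  apply/funext => b; rewrite /N integral_mkcond; apply: eq_integral => t _.
  by rewrite patchE indicE; case: ifPn => _; rewrite ?mulr1 ?mulr0.
apply: measurable_funM; first exact: measurable_tw.
apply: measurableT_comp; first exact: measurable_inv_fun.
apply: measurableT_comp; first exact: fine_measurable.
exact: measurableT_comp mN measurable_fst.
Qed.

Let mtau (b : p.-tuple R) : measurable_fun setT (tau_density a pi_glo b).
Proof.
exact: measurableT_comp measurable_tau_density (measurable_pair1 b).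
Qed.

Lemma tau_density_prob (b : p.-tuple R) :
  \int[pi_glo]_(t in `]0%R, +oo[) (tau_density a pi_glo b t)%:E = 1.
Proof.
under eq_integral do rewrite /tau_density /normalized mulrC EFinM.
rewrite ge0_integralZl//.
- by rewrite -/(N b) [X in _ * X]NE -EFinM mulVf// gt_eqF.
- by apply/measurable_EFinP; exact: measurable_funTS (mtw b).
- by move=> t /itv0P t0; rewrite lee_fin; exact: ltW (tw_gt0 b t0).
- by rewrite lee_fin invr_ge0 ltW//; exact: fN_gt0.
Qed.

Lemma tau_density_prob_min (b : p.-tuple R) :
  \int[pi_glo]_(t in `[tau_min, +oo[) (tau_density a pi_glo b t)%:E = 1.
Proof.
rewrite -(tau_density_prob b) integral_tau//.
- by apply/measurable_EFinP; exact: measurable_funTS.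
- by move=> t t0; rewrite lee_fin tau_density_ge0.
Qed.

End tau_step.

(** * The Gibbs kernel *)

Lemma lee_prod (R : realDomainType) (I : Type) (r : seq I) (f h : I -> \bar R) :
  (forall i, 0 <= f i)%E -> (forall i, f i <= h i)%E ->
  (\prod_(i <- r) f i <= \prod_(i <- r) h i)%E.
Proof.
move=> f0 fh; elim: r => [|i r IH]; first by rewrite !big_nil.
by rewrite !big_cons lee_pmul// prode_ge0.
Qed.

Lemma eq_is_pker d d' (X : measurableType d) (Z : measurableType d') (R : realType)
    (F F' : X -> set Z -> \bar R) :
  (forall x A, measurable A -> F x A = F' x A) -> is_pker F -> is_pker F'.
Proof. by move=> FF' [K KF]; exists K => x A mA; rewrite KF// FF'. Qed.

Section kernel_precomposition.
Context d d' d'' (X : measurableType d) (Y : measurableType d')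
  (Z : measurableType d'') (R : realType).
Variables (K : R.-pker Y ~> Z) (f : X -> Y) (mf : measurable_fun setT f).

Let kf of measurable_fun setT f := fun x => K (f x) : {measure set Z -> \bar R}.

Let measurable_kf A : measurable A -> measurable_fun setT (kf mf ^~ A).
Proof. by move=> mA; exact: measurableT_comp (measurable_kernel K A mA) mf. Qed.

HB.instance Definition _ := isKernel.Build _ _ _ _ _ (kf mf) measurable_kf.

Lemma is_pker_precomp : is_pker (fun x A => K (f x) A).
Proof.
have kf1 x : kf mf x setT = 1%E by exact: pker1.
by have [K' K'E] := pker_of_ker kf1; exists K' => x A mA; rewrite K'E.
Qed.

End kernel_precomposition.

Section gibbs_sampler.
Context {R : realType}.
Variables (n p : nat) (X : 'M[R]_(n, p)) (y : 'I_n -> bool).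
Variables (a zeta : R) (pi_loc : R -> R) (pi_glo : probability R R) (tau_min : R).
Context d (Omega : measurableType d) (P : probability Omega R).
Variable g : 'I_n * nat -> {RV P >-> R}.
Hypotheses (a_gt0 : 0 < a) (zeta_gt0 : 0 < zeta).
Hypothesis loc : bridge_local_prior a pi_loc.
Hypotheses (tau_gt0 : 0 < tau_min) (pi_glo1 : pi_glo `[tau_min, +oo[%classic = 1%E).
Hypothesis iid : iid_exponential g.
Notation lebp := (@lebesgue_tuple R p).
Notation state := (@state R n p).

(** [is_pker_density] asks for total mass 1 at every sample point, not almost surely. With positive
    parts the weights are nonnegative everywhere and the Gaussian density is always normalized. *)
Definition gpos j th : R := Num.max (g j th) 0.

Definition omega_pos (b : p.-tuple R) (th : Omega) : n.-tuple R :=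
  [tuple polya_gamma_sum (fun k => gpos (i, k) th) ((X *m colv b) i ord0) | i < n].

Let gpos_ge0 j th : 0 <= gpos j th.
Proof. by rewrite /gpos le_max lexx orbT. Qed.

Let measurable_gpos j : measurable_fun setT (gpos j).
Proof. exact: measurable_maxr. Qed.

Let omega_pos_ge0 b th i : 0 <= tnth (omega_pos b th) i.
Proof. by rewrite tnth_mktuple polya_gamma_sum_ge0. Qed.

Let measurable_omega_pos :
  measurable_fun setT (fun x : p.-tuple R * Omega => omega_pos x.1 x.2).
Proof.
apply/measurable_fun_tnthP => i.
rewrite (_ : _ \o _ = fun x : p.-tuple R * Omega =>
    polya_gamma_sum (fun k => gpos (i, k) x.2) ((X *m colv x.1) i ord0)); last first.
  by apply/funext => x; rewrite /= tnth_mktuple.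
apply: (measurable_polya_gamma_sum (g := fun k (x : p.-tuple R * Omega) => gpos (i, k) x.2)) => //.
  by move=> k; exact: measurableT_comp (measurable_gpos _) measurable_snd.
have mc : mx_measurable (fun x : p.-tuple R * Omega => X *m colv x.1).
  apply: mx_measurableM; first exact: mx_measurable_cst.
  move=> j k; under eq_fun do rewrite mxE.
  exact: measurableT_comp (measurable_tnth j) measurable_fst.
exact: mc.
Qed.

Let posE : [set l : p.-tuple R | forall j, 0 < tnth l j] =
  [set l | forall j, (`]0, +oo[%classic : set R) (tnth l j)].
Proof.
by apply/seteqP; split => l /= h j; have := h j; rewrite /= in_itv/= andbT.
Qed.

Let measurable_pos : measurable [set l : p.-tuple R | forall j, 0 < tnth l j].
Proof. by rewrite posE; exact: measurable_tuple_all. Qed.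

(** The argument is the history in the order of the draws: old [beta], then [tau], [lambda] and the
    sample point behind [omega]. *)
Definition beta_step (x : ((p.-tuple R * R) * p.-tuple R) * Omega) (A : set state) : \bar R :=
  let: (b, t, l, th) := x in
  (\int[lebp]_b' ((beta_density X y zeta (omega_pos b th) l t b')%:E *
     (\1_A (omega_pos b th, b', l, t))%:E))%E.

Lemma is_pker_beta_step : is_pker beta_step.
Proof.
pose mom := @measurable_omega_pos.
pose om (x : ((p.-tuple R * R) * p.-tuple R) * Omega) := omega_pos x.1.1.1 x.2.
have m111 : measurable_fun setT (fun x : ((p.-tuple R * R) * p.-tuple R) * Omega => x.1.1.1).
  exact: measurableT_comp measurable_fst (measurableT_comp measurable_fst measurable_fst).
have m112 : measurable_fun setT (fun x : ((p.-tuple R * R) * p.-tuple R) * Omega => x.1.1.2).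
  exact: measurableT_comp measurable_snd (measurableT_comp measurable_fst measurable_fst).
have m12 : measurable_fun setT (fun x : ((p.-tuple R * R) * p.-tuple R) * Omega => x.1.2).
  exact: measurableT_comp measurable_snd measurable_fst.
have mo : measurable_fun setT om.
  exact: (measurableT_comp mom (measurable_fun_pair m111 measurable_snd)).
pose F0 (x : (((p.-tuple R * R) * p.-tuple R) * Omega) * p.-tuple R) (A : set state) : \bar R :=
  (\1_A (om x.1, x.2, x.1.1.2, x.1.1.1.2))%:E.
have kF0 : is_pker F0.
  apply: (@is_pker_dirac R _ _ _ _ (fun x : (((p.-tuple R * R) * p.-tuple R) * Omega) * p.-tuple R =>
    (om x.1, x.2, x.1.1.2, x.1.1.1.2))).
  apply: measurable_fun_pair; last exact: measurableT_comp m112 measurable_fst.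
  apply: measurable_fun_pair; last exact: measurableT_comp m12 measurable_fst.
  by apply: measurable_fun_pair; [exact: measurableT_comp mo measurable_fst|exact: measurable_snd].
pose w (x : (((p.-tuple R * R) * p.-tuple R) * Omega) * p.-tuple R) : R :=
  beta_density X y zeta (om x.1) x.1.1.2 x.1.1.1.2 x.2.
apply: (eq_is_pker _ (is_pker_density (mu := lebp) (D := setT) (w := w) measurableT _ _ _ kF0)).
- by move=> [[[b t] l] th] A mA.
- by rewrite setXTT; exact: (measurable_beta_density X y zeta mo m12 m112).
- by move=> x z _; exact: beta_density_ge0.
- move=> x; exact: (beta_density_prob X y zeta_gt0 x.1.2 x.1.1.2 (omega_pos_ge0 x.1.1.1 x.2)).
Qed.

Definition omega_step (x : (p.-tuple R * R) * p.-tuple R) (A : set state) : \bar R :=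
  (\int[P]_th beta_step (x, th) A)%E.

Lemma is_pker_omega_step : is_pker omega_step.
Proof.
apply: (eq_is_pker _ (is_pker_density (mu := P) (D := setT) (w := fun=> 1) measurableT _ _ _ is_pker_beta_step)).
- by move=> x A mA; apply: eq_integral => th _; rewrite mul1e.
- exact: measurable_cst.
- by [].
- by move=> x; rewrite integral_cst// mul1e; exact: probability_setT.
Qed.

Definition lambda_step (x : p.-tuple R * R) (A : set state) : \bar R :=
  (\int[lebp]_(l in [set l | forall j, (0 < tnth l j)%R])
     ((\prod_(j < p) lambda_density pi_loc (tnth x.1 j) x.2 (tnth l j))%:E *
      omega_step (x, l) A))%E.

Let lambda_facts : exists alpha f c, [/\ 0 < alpha, stable_density alpha f, 0 < c &
  forall l, 0 < l -> pi_loc l = c * (l ^- 2 * f (l ^- 2 / 2))].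
Proof.
have [f fst [[c c0 lE] _]] := loc.
by exists (a / 2), f, c; split => //; rewrite divr_gt0.
Qed.

Let lambda_ge0 b t l : 0 < l -> 0 <= lambda_density pi_loc b t l.
Proof.
have [al [f [c [al0 fs c0 lE]]]] := lambda_facts.
exact: (lambda_density_ge0 fs c0 lE).
Qed.

Let measurable_lambda d1 (T : measurableType d1) (D : set T) (b t l : T -> R) :
  measurable D -> measurable_fun D b -> measurable_fun D t -> measurable_fun D l ->
  (forall x, D x -> (0 < l x)%R) ->
  measurable_fun D (fun x => lambda_density pi_loc (b x) (t x) (l x)).
Proof.
have [al [f [c [al0 fs c0 lE]]]] := lambda_facts.
exact: (measurable_lambda_density fs c0 lE).
Qed.

Let lambda_prob b t :
  (\int[lebesgue_measure]_(l in `]0%R, +oo[) (lambda_density pi_loc b t l)%:E = 1)%E.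
Proof.
have [al [f [c [al0 fs c0 lE]]]] := lambda_facts.
exact: (lambda_density_prob fs c0 lE).
Qed.

Let lambda_median : exists2 M : R, (0 < M)%R & forall b t,
  ((2^-1)%:E <= \int[lebesgue_measure]_(l in [set l : R | (0 < l)%R /\ (l ^- 2 / 2 <= M)%R])
     (lambda_density pi_loc b t l)%:E)%E.
Proof.
have [al [f [c [al0 fs c0 lE]]]] := lambda_facts.
exact: (lambda_density_median al0 fs c0 lE).
Qed.

Let itv0P t : (`]0%R, +oo[%classic : set R) t -> (0 < t)%R.
Proof. by rewrite /= in_itv/= andbT. Qed.

Lemma is_pker_lambda_step : is_pker lambda_step.
Proof.
pose w (x : (p.-tuple R * R) * p.-tuple R) : R :=
  \prod_(j < p) lambda_density pi_loc (tnth x.1.1 j) x.1.2 (tnth x.2 j).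
apply: (is_pker_density (mu := lebp) (w := w) measurable_pos _ _ _ is_pker_omega_step).
- apply: measurable_prod => j _; apply: measurable_lambda.
  + exact: measurableX.
  + apply: measurable_funTS; apply: (measurableT_comp (measurable_tnth j)).
    exact: measurableT_comp measurable_fst measurable_fst.
  + apply: measurable_funTS; exact: measurableT_comp measurable_snd measurable_fst.
  + apply: measurable_funTS; exact: measurableT_comp (measurable_tnth j) measurable_snd.
  + by move=> x [_ /= h]; exact: h.
- by move=> x l /= l0; apply: prodr_ge0 => j _; apply: lambda_ge0.
- move=> x; rewrite posE.
  rewrite (integral_lebesgue_tuple_prod_on
    (f := fun j => lambda_density pi_loc (tnth x.1 j) x.2))//.
  + by apply: big1 => j _; exact: lambda_prob.
  + by move=> j; apply: measurable_lambda => // l /itv0P.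
  + by move=> j l /itv0P; exact: lambda_ge0.
Qed.

Definition tau_step (b : p.-tuple R) (A : set state) : \bar R :=
  (\int[pi_glo]_(t in `]0%R, +oo[) ((tau_density a pi_glo b t)%:E * lambda_step (b, t) A))%E.

Lemma is_pker_tau_step : is_pker tau_step.
Proof.
apply: (is_pker_density (mu := pi_glo) (w := fun x => tau_density a pi_glo x.1 x.2)
  (measurable_itv _) _ _ _ is_pker_lambda_step).
- apply: measurable_funTS; exact: measurable_tau_density.
- by move=> b t /itv0P; exact: tau_density_ge0 _ tau_gt0 pi_glo1 _ _.
- by move=> b; exact: tau_density_prob _ tau_gt0 pi_glo1 _.
Qed.

Let inner_ge0 (w : n.-tuple R) (l : p.-tuple R) t (A : set state) :
  (0 <= \int[lebp]_b' ((beta_density X y zeta w l t b')%:E * (\1_A (w, b', l, t))%:E))%E.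
Proof.
by apply: integral_ge0 => z _; rewrite mule_ge0 ?lee_fin ?beta_density_ge0.
Qed.

(** The formulas differ by [g] against its positive part in the integral over [P]; the two agree off
    a null event. *)
Lemma gibbs_transitionE s A :
  gibbs_transition X y a zeta pi_loc pi_glo g s A = tau_step s.1.1.2 A.
Proof.
have [N [mN N0 gN]] := iid_exponential_ge0 iid.
have omegaE b th : ~ N th -> omega_sample X g b th = omega_pos b th.
  move=> Nth; apply: eq_from_tnth => i; rewrite !tnth_mktuple; congr polya_gamma_sum.
  by apply/funext => k; rewrite /gpos max_l// gN.
rewrite /gibbs_transition /tau_step; cbv zeta.
refine (f_equal (integral _ _) _); apply: funext => t.
refine (f_equal (fun z => _ * z)%E _).
rewrite /lambda_step; cbn [fst snd].
refine (f_equal (integral _ _) _); apply: funext => l.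
refine (f_equal (fun z => _ * z)%E _).
rewrite /omega_step.
apply: (ge0_eq_integral_off_null mN N0).
- by move=> th; exact: inner_ge0.
- by move=> th; exact: inner_ge0.
- by move=> th Nth; rewrite /beta_step omegaE.
Qed.

(** The [omega] part of [box_bound] at [beta = 0]. With the exponentials held fixed, every
    Polya-Gamma sum is largest there, so [W] dominates pathwise, for all [beta] at once. *)
Let W th : R := \sum_i tnth (omega_pos [tuple 0 | _ < p] th) i * (\sum_j `|X i j|) ^+ 2.

Let W_ge b th : \sum_i tnth (omega_pos b th) i * (\sum_j `|X i j|) ^+ 2 <= W th.
Proof.
apply: ler_sum => i _; rewrite ler_wpM2r ?sqr_ge0// !tnth_mktuple.
have -> : (X *m colv [tuple 0 | _ < p]) i ord0 = 0.
  by rewrite mxE big1// => j _; rewrite mxE tnth_mktuple mulr0.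
exact: polya_gamma_sum_le0.
Qed.

Let measurable_W : measurable_fun setT W.
Proof.
apply: measurable_sum => i; apply: measurable_funM => //.
apply: (measurableT_comp (measurable_tnth i)).
exact: measurableT_comp measurable_omega_pos (measurable_pair1 _).
Qed.

Lemma tau_step_minorant : exists2 kappa : R, 0 < kappa & forall b (B : set (p.-tuple R)),
  measurable B ->
  (kappa%:E * lebp (B `&` box (R:=R) (p:=p)) <= tau_step b [set s | B s.1.1.2])%E.
Proof.
have [M M0 MP] := lambda_median.
have [M' M'0 M'P] := probability_le_half P measurable_W.
(* Bounds [box_bound] on the good events [W <= M'] and [l^-2 / 2 <= M], that is [l^-2 <= 2 M], when
   [t >= tau_min]; [k3] is the resulting bound on the density. *)
pose Q : R := M' + zeta ^- 2 * p%:R + tau_min ^- 2 * (\sum_(j < p) (2 * M)).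
pose k3 : R := expR (- (Q + zeta ^+ 2 * \sum_j score X y j 0 ^+ 2)) / (normal_peak zeta)^-1 ^+ p.
have k30 : 0 < k3 by rewrite divr_gt0 ?expR_gt0// gaussian_const_gt0.
(* One factor 1/2 pays for [omega], and one for each of the [p] local scales. *)
exists (k3 / 2 / 2 ^+ p); first by rewrite divr_gt0 ?exprn_gt0// divr_gt0.
move=> b B mB; set A := [set s | _].
have mA : measurable A.
  rewrite -[X in measurable X]setTI.
  have mpr : measurable_fun setT (fun s : state => s.1.1.2).
    exact: measurableT_comp measurable_snd (measurableT_comp measurable_fst measurable_fst).
  exact: mpr.
have mBb : measurable (B `&` box (R:=R) (p:=p)) by apply: measurableI => //; exact: measurable_box.
set m := lebp (B `&` _).
have m1 : (m <= 1)%E.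
  rewrite -(lebesgue_box p); apply: le_measure; rewrite ?inE//; exact: measurable_box.
have m0 : (0 <= m)%E by exact: measure_ge0.
have mfin : m \is a fin_num by rewrite ge0_fin_numE// (le_lt_trans m1)// ltry.
have beta_ge0 x : (0 <= beta_step x A)%E.
  by case: x => [[[b' t] l] th]; exact: inner_ge0.
have omega_ge0 x : (0 <= omega_step x A)%E by apply: integral_ge0.
have lambda_step_ge0 x : (0 <= lambda_step x A)%E.
  apply: integral_ge0 => l /= l0; rewrite mule_ge0// lee_fin.
  by apply: prodr_ge0 => j _; exact: lambda_ge0.
pose E := [set l : R | (0 < l)%R /\ (l ^- 2 / 2 <= M)%R].
have mE : measurable E.
  exact: measurable_half_inv_square_le.
have step3 t l th : tau_min <= t -> (forall j, E (tnth l j)) -> W th <= M' ->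
    (k3%:E * m <= beta_step (b, t, l, th) A)%E.
  move=> taut El Wth; rewrite /beta_step /m -(integral_cst lebp mBb).
  apply: ge0_le_integral_subset => //.
  - by move=> z _; rewrite /= lee_fin ltW.
  - by move=> z _; rewrite mule_ge0 ?lee_fin ?beta_density_ge0.
  - move=> z [Bz boxz]; rewrite indicE mem_set//= mule1 lee_fin.
    apply: (le_trans _ (beta_density_box X y zeta_gt0 l t (omega_pos_ge0 b th) boxz)).
    rewrite ler_wpM2r ?invr_ge0 ?(ltW (gaussian_const_gt0 p zeta_gt0))//.
    rewrite ler_expR lerN2 lerD2r /box_bound /Q !lerD//.
      exact: le_trans (W_ge b th) Wth.
    rewrite ler_pM ?invr_ge0 ?sqr_ge0//.
    + by apply: sumr_ge0 => j _; rewrite invr_ge0 sqr_ge0.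
    + rewrite lef_pV2 ?posrE ?exprn_gt0 ?(lt_le_trans tau_gt0)// lerXn2r// nnegrE ltW//.
      exact: lt_le_trans taut.
    + apply: ler_sum => j _; have [_] := El j.
      by rewrite ler_pdivrMr// mulrC.
have step2 t l : tau_min <= t -> (forall j, E (tnth l j)) ->
    ((k3 / 2)%:E * m <= omega_step (b, t, l) A)%E.
  move=> taut El.
  have mWs : measurable [set th | W th <= M'].
    by rewrite -[X in measurable X]setTI; apply: measurable_fun_le => //; exact: measurable_cst.
  apply: (@le_trans _ _ (\int[P]_(th in [set th | (W th <= M')%R]) (k3%:E * m))%E).
    rewrite integral_cst// EFinM -muleA (muleC _ m) muleA lee_wpmul2l//.
    by rewrite mule_ge0// lee_fin ltW.
  apply: ge0_le_integral_subset => //.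
  - by move=> th _; rewrite mule_ge0// lee_fin ltW.
  - by move=> th Wth; exact: step3.
have step1 t : tau_min <= t -> ((k3 / 2 / 2 ^+ p)%:E * m <= lambda_step (b, t) A)%E.
  move=> taut.
  apply: (@le_trans _ _ (\int[lebp]_(l in [set l | forall j, E (tnth l j)])
    ((\prod_(j < p) lambda_density pi_loc (tnth b j) t (tnth l j))%:E * ((k3 / 2)%:E * m)))%E).
    rewrite ge0_integralZr//.
    (* Given [beta] and [tau] the local scales are independent: the mass of the good event is a
       product of [p] factors, each at least 1/2. *)
    - rewrite (integral_lebesgue_tuple_prod_on
        (f := fun j => lambda_density pi_loc (tnth b j) t))//.
      + rewrite [(_ / _ / _)%R]mulrC EFinM -muleA lee_wpmul2r//.
          by rewrite mule_ge0// lee_fin divr_ge0// ltW.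
        apply: (@le_trans _ _ (\prod_(j < p) (2^-1)%:E)%E).
          by rewrite prodEFin prodr_const card_ord exprVn.
        by apply: lee_prod => j; rewrite ?lee_fin// MP.
      + by move=> j; apply: measurable_lambda => // l [].
      + by move=> j l [l0 _]; exact: lambda_ge0.
    - exact: measurable_tuple_all.
    - apply/measurable_EFinP; apply: measurable_prod => j _; apply: measurable_lambda => //.
      + exact: measurable_tuple_all.
      + by apply: measurable_funTS; exact: measurable_tnth.
      + by move=> l El; case: (El j).
    - by move=> l El; rewrite lee_fin prodr_ge0// => j _; apply: lambda_ge0; case: (El j).
    - by rewrite mule_ge0// lee_fin divr_ge0// ltW.
  apply: ge0_le_integral_subset => //.
  - by move=> l El j; case: (El j).
  - move=> l El; rewrite mule_ge0//; first by rewrite lee_fin prodr_ge0// => j _; apply: lambda_ge0; case: (El j).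
    by rewrite mule_ge0// lee_fin divr_ge0// ltW.
  - move=> l l0; rewrite mule_ge0// lee_fin prodr_ge0// => j _; apply: lambda_ge0; exact: l0.
  - move=> l El; rewrite lee_wpmul2l ?step2//.
    by rewrite lee_fin prodr_ge0// => j _; apply: lambda_ge0; case: (El j).
(* The law of [tau] has all its mass on [[tau_min, +oo[], so restricting to this set costs no
   factor. *)
rewrite -[leLHS]mul1e -(tau_density_prob_min a tau_gt0 pi_glo1 b).
have k0 : (0 <= (k3 / 2 / 2 ^+ p)%:E * m)%E.
  by rewrite mule_ge0// lee_fin ltW// divr_gt0 ?exprn_gt0// divr_gt0.
rewrite -ge0_integralZr//; last 2 first.
- apply/measurable_EFinP; apply: measurable_funTS.
  exact: measurableT_comp (measurable_tau_density a pi_glo) (measurable_pair1 b).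
- move=> t /=; rewrite in_itv/= andbT => taut; rewrite lee_fin.
  by apply: (tau_density_ge0 a tau_gt0 pi_glo1); exact: lt_le_trans taut.
apply: ge0_le_integral_subset.
- by apply: subset_itvr; rewrite bnd_simp.
- move=> t /=; rewrite in_itv/= andbT => taut; rewrite mule_ge0// lee_fin.
  by apply: (tau_density_ge0 a tau_gt0 pi_glo1); exact: lt_le_trans taut.
- move=> t /itv0P t0; rewrite mule_ge0// lee_fin.
  exact: (tau_density_ge0 a tau_gt0 pi_glo1).
- move=> t /=; rewrite in_itv/= andbT => taut; rewrite lee_wpmul2l ?step1//.
  rewrite lee_fin; by apply: (tau_density_ge0 a tau_gt0 pi_glo1); exact: lt_le_trans taut.
Qed.

End gibbs_sampler.

Theorem theorem3p1 (R : realType) (n p : nat)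
    (X : 'M[R]_(n, p)) (y : 'I_n -> bool)
    (a zeta : R) (pi_loc : R -> R) (pi_glo : probability R R) (tau_min : R)
    (d : measure_display) (Omega : measurableType d) (P : probability Omega R)
    (g : 'I_n * nat -> {RV P >-> R}) :
  0 < a < 1 -> 0 < zeta ->
  bridge_local_prior a pi_loc ->
  0 < tau_min -> pi_glo `[tau_min, +oo[%classic = 1%E ->
  iid_exponential g ->
  exists2 K : R.-pker (state n p) ~> (state n p),
    gibbs_kernel X y a zeta pi_loc pi_glo g K & uniformly_ergodic K.
Proof.
move=> /andP[a0 _] z0 loc tau0 glo1 iid.
(* [G] leads from [beta] alone to a full state; the sampler is [G] after the projection to
   [beta]. *)
have [G GE] := is_pker_tau_step X y g a0 z0 loc tau0 glo1.
have mb : measurable_fun setT (fun s : state (R:=R) n p => s.1.1.2).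
  exact: measurableT_comp measurable_snd (measurableT_comp measurable_fst measurable_fst).
have [K KE] := is_pker_precomp G mb.
exists K.
  move=> s A mA.
  exact: etrans (KE s A mA) (etrans (GE _ A mA) (esym (gibbs_transitionE _ _ _ _ _ _ iid _ _))).
have [k k0 kP] := tau_step_minorant X y g a0 z0 loc tau0 glo1.
pose mu0 : {measure set (p.-tuple R) -> \bar R} :=
  mscale (NngNum (ltW k0)) (mrestr (lebesgue_tuple p) (@measurable_box R p)).
apply: (uniformly_ergodic_of_minorization (G := G) (b := fun s => s.1.1.2) (mu0 := mu0)) => //.
  move=> b B mB; rewrite GE; first exact: kP.
  by rewrite -[X in measurable X]setTI; exact: mb.
by rewrite /mu0/= /mscale/= /mrestr setTI lebesgue_box mule1 lte_fin.
Qed.
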